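(* Let $k, N$ be positive integers, let $S$ be an invertible positive-definite Hermitian $k\times k$ matrix (a frame operator on $\mathbb{C}^k$), and let $\vec r=(r_1,\dots,r_N)$ be a vector of squared norms that is admissible for $S$. Then the space $$\mathcal{F}_S(\vec r)=\{F=[f_1|\cdots|f_N]\in\mathbb{C}^{k\times N} : F \text{ is a frame},\ FF^\ast=S \text{ and } \|f_j\|^2=r_j \text{ for all } 1\le j\le N\}$$ is path-connected.
   Context: A frame in $\mathbb{C}^k$ is a collection $F=\{f_j\}_{j=1}^N$ of vectors in $\mathbb{C}^k$ for which there exist numbers $0<a\le b$ with $a\|v\|^2\le\sum_{j=1}^N|\langle v,f_j\rangle|^2\le b\|v\|^2$ for all $v\in\mathbb{C}^k$, where $\langle\cdot,\cdot\rangle$ is the standard Hermitian product and $\|\cdot\|$ its norm. A frame is identified with the $k\times N$ complex matrix whose columns are $f_1,\dots,f_N$; its frame operator is $S_F=FF^\ast$, where $F^\ast$ is the conjugate transpose. The space $\mathcal{F}_S(\vec r)$ carries the subspace topology from $\mathbb{C}^{k\times N}$. Admissibility: for an invertible positive-definite Hermitian $k\times k$ matrix $S$, a vector $\vec r=(r_1,\dots,r_N)$ with all $r_i>0$ is admissible if the set $\widetilde{\mathcal F}_S(\vec r)=\{F\in\mathbb{C}^{k\times N} : FF^\ast=USU^\ast \text{ for some } U\in\mathrm{U}(k),\ \|f_i\|^2=r_i \text{ for all } i\}$ is nonempty, where $\mathrm{U}(k)$ is the group of $k\times k$ unitary matrices. *)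

(* Defs.v *)
From HB Require Import structures.
From mathcomp Require Import all_boot all_order all_algebra spectral.
From mathcomp Require Import complex.
From mathcomp Require Import all_classical all_reals topology normedtype.

Set Implicit Arguments.
Unset Strict Implicit.
Unset Printing Implicit Defensive.

Import Order.TTheory GRing.Theory Num.Theory.
Import numFieldTopology.Exports numFieldNormedType.Exports.

Local Open Scope classical_set_scope.
Local Open Scope complex_scope.
Local Open Scope sesquilinear_scope.
Local Open Scope ring_scope.

(* The usual topology of the complex numbers, given by the modulus; it makes
   'M[R[i]]_(k, N) a topological space through the product topology. *)
HB.instance Definition _ (R : realType) := NormedModule.copy R[i] R[i]^o.

Definition path_connected (R : realType) (T : topologicalType) (A : set T) :=
  A !=set0 /\
  forall x y, A x -> A y ->
    exists f : R -> T,
      [/\ {within `[0, 1], continuous f}, f 0 = x, f 1 = y &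
          forall t, 0 <= t <= 1 -> A (f t)].

Section Frames.
Context {R : realType}.

(* <v, w> = \sum_i v_i * conj(w_i); dotmx is the same form on row vectors. *)
Definition hdot k (v w : 'cV[R[i]]_k) : R[i] := dotmx v^T w^T.

(* The order of R[i] is the partial order for which x <= y holds when y - x is
   a nonnegative real; the three terms compared below are real. *)
Definition is_frame k N (F : 'M[R[i]]_(k, N)) :=
  exists a b : R, [/\ 0 < a, a <= b &
    forall v : 'cV[R[i]]_k,
      a%:C * hdot v v <= \sum_(j < N) `|hdot v (col j F)| ^+ 2
                      <= b%:C * hdot v v].

Definition has_sqnorms k N (r : 'I_N -> R) (F : 'M[R[i]]_(k, N)) :=
  forall j, hdot (col j F) (col j F) = (r j)%:C.

Definition posdefmx k (S : 'M[R[i]]_k) :=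
  S \is hermsymmx /\ forall v : 'cV[R[i]]_k, v != 0 -> 0 < hdot (S *m v) v.

Definition frames_up_to_unitary k N (S : 'M[R[i]]_k) (r : 'I_N -> R) :
    set 'M[R[i]]_(k, N) :=
  [set F | (exists2 U : 'M[R[i]]_k,
              U \is unitarymx & F *m F ^t* = U *m S *m U ^t*)
           /\ has_sqnorms r F].

Definition admissible k N (S : 'M[R[i]]_k) (r : 'I_N -> R) :=
  (forall j, 0 < r j) /\ frames_up_to_unitary S r !=set0.

Definition frame_space k N (S : 'M[R[i]]_k) (r : 'I_N -> R) :
    set 'M[R[i]]_(k, N) :=
  [set F | [/\ is_frame F, F *m F ^t* = S & has_sqnorms r F]].

End Frames.

(* Main.v *)
(** Successively removing the columns of [F] changes the frame operator by rank-one terms, and the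
    spectra of the partial frame operators interlace (eigensteps, or Gelfand-Tsetlin patterns).
    Interlacing and the trace conditions are linear, so the patterns of frames with given operator
    and column norms form a convex set. Along a segment of patterns the rank-one steps have explicit
    solutions, of Cauchy-matrix type, whose squared entries are bounded rational functions of the
    parameter and therefore extend continuously to the ends. At a fixed pattern, two solutions of a
    rank-one step differ by unitaries commuting with the two diagonal matrices involved, and such
    unitaries are joined to the identity by their spectral decomposition. *)

Require Import Defs.
From mathcomp Require Import all_boot all_order all_fingroup all_algebra qpoly spectral complex.
From mathcomp Require Import all_classical all_reals topology normedtype derive realfun.
From mathcomp Require Import ring lra zify.

Set Implicit Arguments.
Unset Strict Implicit.
Unset Printing Implicit Defensive.

Import Order.TTheory GRing.Theory Num.Theory.
Import numFieldTopology.Exports numFieldNormedType.Exports.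

Local Open Scope classical_set_scope.
Local Open Scope ring_scope.

(** * Rational functions on the unit interval *)

Section RealFunctions.
Context {R : realType}.
Implicit Types (h g : R -> R) (t : R).

(** The obstacle is that eigenvectors of a path of matrices may jump where eigenvalues collide, and
    collisions cannot be avoided: a partial frame with fewer than [k] columns has a kernel. Segments
    of patterns tame this. With spectra listed in descending order, a difference [l i - m j] of
    interlaced spectra has a fixed sign at both ends and is affine in between, so if it vanishes at
    an interior point it vanishes throughout. A collision is therefore either permanent, and can be
    split off, or confined to the ends, where a bounded rational function has a limit. The lift of a
    segment obtained in this way uses real matrices and its own eigenvectors; it does not pass
    through the two given frames, but only meets their fibers. Each column thus costs three pieces
    of path: a motion in a fiber, the lift, and another motion in a fiber. Even if two frames have
    the same operator, their partial operators have different spectra, so the induction on the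
    number of columns must allow independent spectra and norms at the two ends. *)

Lemma continuousR_sum (I : Type) (s : seq I) (P : pred I) (F : I -> R -> R) :
  (forall i, P i -> continuous (F i)) -> continuous (fun t => \sum_(i <- s | P i) F i t).
Proof. by move=> Fc; apply: continuous_big => //; exact: add_continuous. Qed.

Lemma continuousR_mul h g : continuous h -> continuous g -> continuous (fun t => h t * g t).
Proof. by move=> hc gc t; apply: cvgM; [exact: hc|exact: gc]. Qed.

Lemma continuousR_add h g : continuous h -> continuous g -> continuous (fun t => h t + g t).
Proof. by move=> hc gc t; apply: cvgD; [exact: hc|exact: gc]. Qed.

Lemma continuousR_opp h : continuous h -> continuous (fun t => - h t).
Proof. by move=> hc t; apply: cvgN; exact: hc. Qed.

Lemma continuousR_inv h : (forall t, h t != 0) -> continuous h -> continuous (fun t => (h t)^-1).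
Proof. by move=> h0 hc t; apply: cvgV; [exact: h0|exact: hc]. Qed.

Lemma continuousR_comp h g : continuous h -> continuous g -> continuous (fun t => h (g t)).
Proof. by move=> hc gc t; apply: continuous_comp; [exact: gc|exact: hc]. Qed.

Lemma continuousR_sqrt h : continuous h -> continuous (fun t => Num.sqrt (h t)).
Proof. by move=> hc; apply: continuousR_comp => //; exact: sqrt_continuous. Qed.

Lemma continuousR_id : continuous (fun t : R => t).
Proof. by move=> t; exact: cvg_id. Qed.

Definition lerp (a b t : R) : R := (1 - t) * a + t * b.

Lemma lerp_continuous (a b : R) : continuous (lerp a b).
Proof.
apply: continuousR_add; apply: continuousR_mul; try exact: cst_continuous.
  by apply: continuousR_add; [exact: cst_continuous|apply: continuousR_opp; exact: continuousR_id].
exact: continuousR_id.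
Qed.

Lemma lerp0 (a b : R) : lerp a b 0 = a. Proof. by rewrite /lerp; ring. Qed.

Lemma lerp1 (a b : R) : lerp a b 1 = b. Proof. by rewrite /lerp; ring. Qed.

Lemma lerp_sum k (a b : 'I_k -> R) t :
  \sum_i lerp (a i) (b i) t = lerp (\sum_i a i) (\sum_i b i) t.
Proof. by rewrite /lerp big_split /= -!mulr_sumr. Qed.

(** Paths are made continuous on all of [R] although they are controlled only on the unit interval;
    composing with this retraction reconciles the two. *)
Definition clamp t : R := Num.max 0 (Num.min 1 t).

Lemma clamp_continuous : continuous clamp.
Proof.
move=> t; apply: (@continuous_max _ _ (fun=> 0) (fun s : R => Num.min 1 s : R^o)).
  exact: cst_continuous.
apply: (@continuous_min _ _ (fun=> 1) (fun s : R => s : R^o)); first exact: cst_continuous.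
exact: cvg_id.
Qed.

Lemma clamp_itv t : 0 <= clamp t <= 1.
Proof. by rewrite /clamp le_max lexx ge_max ler01 ge_min lexx. Qed.

Lemma clamp_id t : 0 <= t <= 1 -> clamp t = t.
Proof. by rewrite /clamp => /andP[??]; rewrite min_r// max_r. Qed.

Lemma clamp_ge1 t : 1 <= t -> clamp t = 1.
Proof. by rewrite /clamp => ?; rewrite min_l// max_r. Qed.

Lemma clamp_le0 t : t <= 0 -> clamp t = 0.
Proof. by rewrite /clamp => ?; rewrite min_r ?max_l//; lra. Qed.

Lemma ge0_itv_closure h : continuous h -> (forall t, 0 < t < 1 -> 0 <= h t) ->
  forall t, 0 <= t <= 1 -> 0 <= h t.
Proof.
move=> hc h0 t /andP[t0 t1]; rewrite leNgt; apply/negP => ht.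
have /cvgrPdist_lt /(_ (- h t)) := hc t; rewrite oppr_gt0 => /(_ ht).
move=> /nbhs_ballP[e /= e0 He].
(* The point [(1 - d) * t + d / 2] is [t] shifted towards the midpoint by at most [d / 2]: it is
   interior to the interval and still in the ball. *)
pose d := Num.min e 1 / 2.
have e1 : 0 < Num.min e 1 by rewrite lt_min e0 ltr01.
have [em m1] : Num.min e 1 <= e /\ Num.min e 1 <= 1 by rewrite !ge_min !lexx orbT.
have sP : 0 < (1 - d) * t + d / 2 < 1 by rewrite /d; apply/andP; split; nra.
have /He : ball t e ((1 - d) * t + d / 2).
  rewrite /ball /= ltr_norml /d; apply/andP; split; nra.
have := h0 _ sP; rewrite ltr_norml => ? /andP[]; lra.
Qed.

Lemma eq_itv_closure h g : continuous h -> continuous g ->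
  (forall t, 0 < t < 1 -> h t = g t) -> forall t, 0 <= t <= 1 -> h t = g t.
Proof.
move=> hc gc e t t01; apply/eqP; rewrite eq_le -subr_ge0 -[in X in _ && X]subr_ge0.
apply/andP; split.
- apply: (@ge0_itv_closure (fun s => g s - h s)) => // [|s /e ->]; last by rewrite subrr.
  by apply: continuousR_add => //; exact: continuousR_opp.
- apply: (@ge0_itv_closure (fun s => h s - g s)) => // [|s /e ->]; last by rewrite subrr.
  by apply: continuousR_add => //; exact: continuousR_opp.
Qed.

(** Nothing is asked at [0] and [1], because the denominators of the Cauchy weights may vanish
    there. *)
Definition rational_itv h := exists p q : {poly R},
  forall t, 0 < t < 1 -> q.[t] != 0 /\ h t = p.[t] / q.[t].

Lemma rational_itv_lerp (a b : R) : rational_itv (lerp a b).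
Proof.
exists (a%:P + (b - a) *: 'X), 1 => t _; rewrite !hornerE oner_eq0; split => //.
by rewrite divr1 /lerp; ring.
Qed.

Lemma rational_itv_cst (a : R) : rational_itv (fun=> a).
Proof. by exists a%:P, 1 => t _; rewrite !hornerE oner_eq0 divr1. Qed.

Lemma rational_itvD h g : rational_itv h -> rational_itv g -> rational_itv (fun t => h t + g t).
Proof.
move=> [p [q H]] [p' [q' H']]; exists (p * q' + p' * q), (q * q') => t t01.
have [[q0 ->] [q'0 ->]] := (H t t01, H' t t01).
by rewrite hornerD !hornerM mulf_neq0//; split=> //; field; rewrite q0 q'0.
Qed.

Lemma rational_itvM h g : rational_itv h -> rational_itv g -> rational_itv (fun t => h t * g t).
Proof.
move=> [p [q H]] [p' [q' H']]; exists (p * p'), (q * q') => t t01.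
have [[q0 ->] [q'0 ->]] := (H t t01, H' t t01).
by rewrite !hornerM mulf_neq0//; split=> //; rewrite invfM mulrACA.
Qed.

Lemma rational_itvV h : (forall t, 0 < t < 1 -> h t != 0) -> rational_itv h ->
  rational_itv (fun t => (h t)^-1).
Proof.
move=> h0 [p [q H]]; exists q, p => t t01; have [q0 e] := H t t01.
have p0 : p.[t] != 0 by apply: contra_neq (h0 t t01) => p0; rewrite e p0 mul0r.
by rewrite e invf_div.
Qed.

Lemma rational_itvN h : rational_itv h -> rational_itv (fun t => - h t).
Proof.
move=> [p [q H]]; exists (- p), q => t t01; have [q0 e] := H t t01.
by rewrite !hornerE e mulNr.
Qed.

Lemma rational_itv_sum (I : Type) (s : seq I) (P : pred I) (F : I -> R -> R) :
  (forall i, P i -> rational_itv (F i)) -> rational_itv (fun t => \sum_(i <- s | P i) F i t).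
Proof.
move=> Fr; elim: s => [|i s IH].
  have -> : (fun t => \sum_(i <- [::] | P i) F i t) = fun=> 0.
    by apply/funext => t; rewrite big_nil.
  exact: rational_itv_cst.
have -> : (fun t => \sum_(i <- i :: s | P i) F i t) =
    fun t => if P i then F i t + \sum_(i <- s | P i) F i t else \sum_(i <- s | P i) F i t.
  by apply/funext => t; rewrite big_cons.
by case Pi : (P i) => //; apply: rational_itvD => //; exact: Fr.
Qed.

Lemma rational_itv_prod (I : Type) (s : seq I) (P : pred I) (F : I -> R -> R) :
  (forall i, P i -> rational_itv (F i)) -> rational_itv (fun t => \prod_(i <- s | P i) F i t).
Proof.
move=> Fr; elim: s => [|i s IH].
  have -> : (fun t => \prod_(i <- [::] | P i) F i t) = fun=> 1.
    by apply/funext => t; rewrite big_nil.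
  exact: rational_itv_cst.
have -> : (fun t => \prod_(i <- i :: s | P i) F i t) =
    fun t => if P i then F i t * \prod_(i <- s | P i) F i t else \prod_(i <- s | P i) F i t.
  by apply/funext => t; rewrite big_cons.
by case Pi : (P i) => //; apply: rational_itvM => //; exact: Fr.
Qed.

(* Once the fraction is reduced, boundedness rules out poles at the endpoints. *)
Lemma rational_itv_extend h (C : R) : rational_itv h -> (forall t, 0 < t < 1 -> `|h t| <= C) ->
  exists2 g, continuous g & forall t, 0 < t < 1 -> g t = h t.
Proof.
move=> [p [q H]] hC.
pose d := gcdp p q; pose p' := p %/ d; pose q' := q %/ d.
have hf : 0 < 2^-1 :> R by lra.
have q0 : q != 0.
  have [] := H 2^-1; first by apply/andP; split; lra.
  by move=> + _; apply: contra_neq => ->; rewrite horner0.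
have pE : p = p' * d by rewrite divpK // dvdp_gcdl.
have qE : q = q' * d by rewrite divpK // dvdp_gcdr.
have cop : coprimep p' q' by rewrite coprimep_div_gcd // q0 orbT.
have dn t : 0 < t < 1 -> q'.[t] != 0 /\ h t = p'.[t] / q'.[t].
  move=> t01; have [] := H t t01; rewrite qE pE !hornerM mulf_eq0 negb_or => /andP[a b] ->.
  by split=> //; field; rewrite a b.
(* Squaring turns the bound into an inequality between polynomials, which passes to the closed
   interval; a zero of [q'] there would be a common root of [p'] and [q']. *)
have bd : forall t, 0 <= t <= 1 -> 0 <= (C * q'.[t]) ^+ 2 - p'.[t] ^+ 2.
  apply: ge0_itv_closure => [|t t01].
    apply: continuousR_add; [|apply: continuousR_opp]; apply: continuousR_mul;
    do ?[exact: continuous_horner|apply: continuousR_mul|exact: cst_continuous].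
  have [a e] := dn t t01; have := hC t t01; rewrite e normrM normfV.
  rewrite ler_pdivrMr ?normr_gt0 // => le; rewrite subr_ge0.
  have le' := le_trans le (_ : _ <= `|C * q'.[t]|).
  rewrite -[leLHS]real_normK ?num_real // -[leRHS]real_normK ?num_real //.
  by rewrite ler_sqr ?nnegrE //; apply: le'; rewrite normrM ler_wpM2r // ler_norm.
have q'0 t : 0 <= t <= 1 -> q'.[t] != 0.
  move=> t01; apply/negP => /eqP z; have := bd t t01; rewrite z.
  move=> pz; have pz' : p'.[t] == 0 by rewrite -sqrf_eq0 eq_le sqr_ge0 andbT; lra.
  by have := coprimep_root cop pz'; rewrite z eqxx.
exists (fun t => p'.[clamp t] / q'.[clamp t]) => [|t t01].
  apply: continuousR_mul.
    by apply: continuousR_comp; [exact: continuous_horner|exact: clamp_continuous].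
  apply: continuousR_inv => [t|]; first by apply/q'0/clamp_itv.
  by apply: continuousR_comp; [exact: continuous_horner|exact: clamp_continuous].
by rewrite clamp_id; [have [_ ->] := dn t t01|case/andP: t01 => /ltW -> /ltW].
Qed.

End RealFunctions.

(** * Strictly interlacing sequences *)

Section Lagrange.
Context {K : fieldType}.

(** Interpolation at [k] distinct points reproduces [p], and the unnormalized basis polynomials are
    monic of degree [k - 1]. The coefficient on the right may be [0], when [p] has smaller
    degree. *)
Lemma lagrange_lead_coef k (x : 'I_k -> K) (p : {poly K}) :
  injective x -> (size p <= k)%N ->
  \sum_i p.[x i] / \prod_(l | l != i) (x i - x l) = p`_(k.-1).
Proof.
move=> xI sp.
pose N i := \prod_(l | l != i) ('X - (x l)%:P).
pose c i := p.[x i] / \prod_(l | l != i) (x i - x l).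
have NE i j : (N i).[x j] = if j == i then \prod_(l | l != i) (x i - x l) else 0.
  rewrite horner_prod; case: eqVneq => [->|ji].
    by apply: eq_bigr => l _; rewrite hornerXsubC.
  by rewrite (bigD1 j) //= hornerXsubC subrr mul0r.
have sN i : size (N i) = k.
  rewrite /N -big_filter size_prod_XsubC -sum1_size big_filter sum1_card cardC1 card_ord.
  by rewrite prednK // (leq_trans _ (ltn_ord i)).
have NL i : (N i)`_(k.-1) = 1 by rewrite -(sN i) -lead_coefE; apply/monicP/monic_prod_XsubC.
suff pE : p = \sum_i c i *: N i.
  by rewrite [in RHS]pE coef_sum; apply: eq_bigr => i _; rewrite coefZ NL mulr1.
apply/eqP; rewrite -subr_eq0; apply/eqP.
apply: (@roots_geq_poly_eq0 _ _ (map x (enum 'I_k))).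
- apply/allP => _ /mapP[j _ ->]; rewrite /root hornerD hornerN horner_sum.
  rewrite (bigD1 j) //= big1 => [|i ij]; last first.
    by rewrite hornerZ NE eq_sym (negbTE ij) mulr0.
  rewrite hornerZ NE eqxx addr0 /c divfK ?subrr //.
  by apply/prodf_neq0 => l lj; rewrite subr_eq0; apply: contra_neq lj => /xI.
- by rewrite map_inj_uniq // enum_uniq.
- rewrite size_map size_enum_ord (leq_trans (size_polyD _ _)) // geq_max sp size_polyN.
  apply: (leq_trans (size_sum _ _ _)); apply/bigmax_leqP => i _.
  by rewrite (leq_trans (size_scale_leq _ _)) // sN.
Qed.

End Lagrange.

Section RankOneStrict.
Context {R : realType} (k : nat).
Implicit Types (l m : 'I_k -> R).

(** The chain [l 0 >= m 0 >= l 1 >= m 1 >= ...], stated for all pairs and not only for neighbours: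
    it then contains the monotonicity of both sequences and is easily restricted to subsequences. *)
Definition interlaced l m :=
  (forall i j : 'I_k, (i <= j)%N -> m j <= l i) /\
  (forall i j : 'I_k, (i < j)%N -> l j <= m i).

Definition strictly_interlaced l m :=
  (forall i j : 'I_k, (i <= j)%N -> m j < l i) /\
  (forall i j : 'I_k, (i < j)%N -> l j < m i).

(* When [l] and [m] strictly interlace, [m] is the spectrum of [diag l - f f^T] exactly when
   [f i ^+ 2 = cauchy_weight l m i]; [cauchy_entry] gives the squares of the entries of its
   normalized eigenvectors [(diag l - m j)^-1 f]. *)
Definition cauchy_weight l m i : R :=
  (l i - m i) * \prod_(j | j != i) ((l i - m j) / (l i - l j)).

Definition cauchy_norm l m j : R := \sum_i cauchy_weight l m i / (l i - m j) ^+ 2.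

Definition cauchy_entry l m i j : R :=
  cauchy_weight l m i / (l i - m j) ^+ 2 / cauchy_norm l m j.

Context (l m : 'I_k -> R) (lm : strictly_interlaced l m).

Lemma strictly_interlaced_sub_neq0 i j : l i - m j != 0.
Proof.
have [le1 le2] := lm; rewrite subr_eq0; case: (leqP i j) => [/le1|/le2] h.
  by rewrite gt_eqF.
by rewrite lt_eqF.
Qed.

Lemma strictly_interlaced_lt (i j : 'I_k) : (i < j)%N -> l j < l i.
Proof. by move=> ij; have [le1 le2] := lm; rewrite (lt_trans (le2 i j ij)) // le1. Qed.

Lemma strictly_interlaced_inj : injective l.
Proof.
move=> i j e; apply/val_inj/eqP; case: ltngtP => // /strictly_interlaced_lt; rewrite e ltxx //.
Qed.

Lemma strictly_interlaced_inj_r : injective m.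
Proof.
have [le1 le2] := lm; move=> i j e; apply/val_inj/eqP; case: ltngtP => // h.
  by have := lt_trans (le1 j j (leqnn j)) (le2 _ _ h); rewrite e ltxx.
by have := lt_trans (le1 i i (leqnn i)) (le2 _ _ h); rewrite e ltxx.
Qed.

(** In each factor of the product, numerator and denominator have the same sign: positive for
    [i < j], negative for [j < i]. *)
Lemma cauchy_weight_gt0 i : 0 < cauchy_weight l m i.
Proof.
have [le1 le2] := lm; apply: mulr_gt0; first by rewrite subr_gt0 le1.
apply: prodr_gt0 => j ji; case: (ltngtP i j) => [h|h|/val_inj e].
- by rewrite divr_gt0 // subr_gt0 ?le1 1?ltnW // strictly_interlaced_lt.
- by rewrite -mulrNN -invrN !opprB divr_gt0 // subr_gt0 ?le2 // strictly_interlaced_lt.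
- by rewrite e eqxx in ji.
Qed.

Lemma cauchy_norm_gt0 j : 0 < cauchy_norm l m j.
Proof.
rewrite /cauchy_norm (bigD1 j) //= ltr_pwDl //.
  by rewrite divr_gt0 ?cauchy_weight_gt0 // exprn_even_gt0 //= strictly_interlaced_sub_neq0.
by apply: sumr_ge0 => i _; rewrite divr_ge0 ?sqr_ge0 ?(ltW (cauchy_weight_gt0 _)).
Qed.

(* Read off as the leading coefficient in Lagrange interpolation at the [l i]. *)
Lemma cauchy_secular j : \sum_i cauchy_weight l m i / (l i - m j) = 1.
Proof.
pose p := \prod_(a | a != j) ('X - (m a)%:P).
have sp : size p = k.
  rewrite /p -big_filter size_prod_XsubC -sum1_size big_filter sum1_card cardC1 card_ord prednK //.
  by rewrite (leq_trans _ (ltn_ord j)).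
have <- : p`_(k.-1) = 1 by rewrite -sp -lead_coefE; apply/monicP/monic_prod_XsubC.
rewrite -(lagrange_lead_coef strictly_interlaced_inj) ?sp //; apply: eq_bigr => i _.
rewrite /cauchy_weight prodf_div horner_prod mulrA mulrAC; congr (_ / _).
have -> : (l i - m i) * \prod_(a | a != i) (l i - m a) = \prod_a (l i - m a).
  by rewrite [RHS](bigD1 i).
rewrite (bigD1 j) //= mulrAC divff ?strictly_interlaced_sub_neq0 // mul1r.
by apply: eq_bigr => a _; rewrite hornerXsubC.
Qed.

Let g i := Num.sqrt (cauchy_weight l m i).
(** The sign is that of [l i - m j], so this is the matrix of normalized eigenvectors. It depends
    only on the indices, hence not on the parameter of a path. *)
Let V (i j : 'I_k) : R := (-1) ^+ (j < i)%N * Num.sqrt (cauchy_entry l m i j).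

Let gsq i : g i * g i = cauchy_weight l m i.
Proof. by rewrite -expr2 sqr_sqrtr // ltW // cauchy_weight_gt0. Qed.

Let n j := Num.sqrt (cauchy_norm l m j).
Let n0 j : n j != 0. Proof. by rewrite sqrtr_eq0 -ltNge cauchy_norm_gt0. Qed.

Let VE i j : V i j = g i / (l i - m j) / n j.
Proof.
have [le1 le2] := lm; have g0 : 0 <= g i by exact: sqrtr_ge0.
have ng0 : 0 <= n j by exact: sqrtr_ge0.
have -> : V i j = (-1) ^+ (j < i)%N * `|g i / (l i - m j) / n j|.
  rewrite /V -sqrtr_sqr; congr (_ * Num.sqrt _).
  rewrite !exprMn !exprVn sqr_sqrtr ?(ltW (cauchy_weight_gt0 _)) //.
  by rewrite sqr_sqrtr ?(ltW (cauchy_norm_gt0 _)).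
rewrite !normrM !normfV (ger0_norm g0) (ger0_norm ng0) 2!mulrA; congr (_ / _).
case: ltnP => [/le2 h|/le1 h].
  by rewrite ltr0_norm ?subr_lt0 // expr1 mulN1r invrN mulrNN.
by rewrite gtr0_norm ?subr_gt0 // expr0 mul1r.
Qed.

Let cols a b : \sum_i V i a * V i b = (a == b)%:R.
Proof.
have [->|ab] := eqVneq a b.
  transitivity ((\sum_i cauchy_weight l m i / (l i - m b) ^+ 2) / (n b * n b)).
    rewrite mulr_suml; apply: eq_bigr => i _; rewrite VE -gsq -/(n b).
    by field; rewrite n0 strictly_interlaced_sub_neq0.
  by rewrite -expr2 sqr_sqrtr ?(ltW (cauchy_norm_gt0 _)) // divff // gt_eqF ?cauchy_norm_gt0.
have mab : m a - m b != 0.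
  by rewrite subr_eq0; apply: contra_neq ab => /strictly_interlaced_inj_r.
(* Partial fractions: the product of [1 / (l i - m a)] and [1 / (l i - m b)] is their difference
   over [m a - m b], and both secular sums equal [1]. *)
transitivity (((\sum_i cauchy_weight l m i / (l i - m a)) - (\sum_i cauchy_weight l m i / (l i - m b)))
    / ((m a - m b) * n a * n b)); last by rewrite !cauchy_secular subrr mul0r.
rewrite -sumrB mulr_suml; apply: eq_bigr => i _; rewrite !VE -/(n a) -/(n b) -gsq.
by field; rewrite !n0 mab !strictly_interlaced_sub_neq0.
Qed.

Let gV b : \sum_i g i * V i b = (n b)^-1.
Proof.
transitivity ((\sum_i cauchy_weight l m i / (l i - m b)) / n b); last first.
  by rewrite cauchy_secular mul1r.
by rewrite mulr_suml; apply: eq_bigr => i _; rewrite VE -gsq -/(n b) !mulrA.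
Qed.

Lemma cauchy_rows i j : \sum_a V i a * V j a = (i == j)%:R.
Proof.
pose M : 'M[R]_k := \matrix_(i, j) V i j.
have MM : M^T *m M = 1%:M.
  apply/matrixP => a b; rewrite !mxE -cols; apply: eq_bigr => c _; by rewrite !mxE.
have /matrixP/(_ i j) := mulmx1C MM; rewrite !mxE => <-.
by apply: eq_bigr => c _; rewrite !mxE.
Qed.

Lemma cauchy_diag i j : \sum_a m a * (V i a * V j a) + g i * g j = l i *+ (i == j).
Proof.
(* The eigenvector equation of [diag l - g g^T] for column [a]; the secular equation enters through
   [gV]. Summing against the rows, which are orthonormal, gives the matrix identity. *)
have E a : l i * V i a = V i a * m a + g i * (\sum_c g c * V c a).
  by rewrite gV VE -/(n a); field; rewrite n0 strictly_interlaced_sub_neq0.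
rewrite -mulr_natr -cauchy_rows mulr_sumr.
under [RHS]eq_bigr do rewrite mulrA E mulrDl.
rewrite big_split /=; congr (_ + _); first by apply: eq_bigr => a _; ring.
under eq_bigr => a _ do rewrite -mulrA mulr_suml.
rewrite -mulr_sumr; congr (_ * _); rewrite exchange_big /=.
transitivity (\sum_c g c * (c == j)%:R).
  by rewrite (bigD1 j) //= eqxx mulr1 big1 ?addr0 // => c /negbTE ->; rewrite mulr0.
apply: eq_bigr => c _; rewrite -cauchy_rows mulr_sumr; apply: eq_bigr => a _; ring.
Qed.

End RankOneStrict.

(** * Rank-one updates along a segment of spectra *)

Section RankOneSection.
Context {R : realType}.

(** Entrywise form of: [V] is orthogonal and [V diag(m) V^T + g g^T = diag(l)]. *)
Definition rank_one_path k (l m : R -> 'I_k -> R)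
    (g : 'I_k -> R -> R) (V : 'I_k -> 'I_k -> R -> R) :=
  [/\ forall i, continuous (g i), forall i j, continuous (V i j) &
  forall t, 0 <= t <= 1 ->
  (forall i j, \sum_a V i a t * V j a t = (i == j)%:R) /\
  (forall i j, \sum_a m t a * (V i a t * V j a t) + g i t * g j t = l t i *+ (i == j))].

(* The squared entries are bounded rational functions of [t] on the open interval, hence extend to
   its ends even though the interlacing may degenerate there; their signs are constant. *)
Lemma strict_rank_one_section k (l0 l1 m0 m1 : 'I_k -> R) :
  interlaced l0 m0 -> interlaced l1 m1 ->
  (forall i j, l0 i = m0 j -> l1 i <> m1 j) ->
  exists g V, rank_one_path (fun t i => lerp (l0 i) (l1 i) t) (fun t i => lerp (m0 i) (m1 i) t) g V.
Proof.
move=> [A0 B0] [A1 B1] ne.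
pose l t i := lerp (l0 i) (l1 i) t; pose m t i := lerp (m0 i) (m1 i) t.
have lm t : 0 < t < 1 -> strictly_interlaced (l t) (m t).
  move=> /andP[t0 t1]; split=> i j ij; rewrite /l /m /lerp.
    have := A0 _ _ ij; have := A1 _ _ ij; have := ne i j.
    rewrite [m0 j <= _]le_eqVlt => h h1 /orP[/eqP e|h0]; last by nra.
    have : m1 j != l1 i by apply/eqP => /esym; apply: h.
    by move: h1; rewrite le_eqVlt => /orP[->//|h1 _]; nra.
  have := B0 _ _ ij; have := B1 _ _ ij; have := ne j i.
  rewrite [l0 j <= _]le_eqVlt => h h1 /orP[/eqP e|h0]; last by nra.
  have : l1 j != m1 i by apply/eqP; apply: h.
  by move: h1; rewrite le_eqVlt => /orP[->//|h1 _]; nra.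
have d0 i j t : 0 < t < 1 -> l t i - m t j != 0.
  by move=> t01; exact: (strictly_interlaced_sub_neq0 (lm t t01)).
have rsub (a b c d : R) : rational_itv (fun t => lerp a b t - lerp c d t).
  by apply: rational_itvD; [|apply: rational_itvN]; exact: rational_itv_lerp.
have rw i : rational_itv (fun t => cauchy_weight (l t) (m t) i).
  apply: rational_itvM; first exact: rsub.
  apply: rational_itv_prod => j ji; apply: rational_itvM; first exact: rsub.
  apply: rational_itvV; last exact: rsub.
  move=> t /lm /strictly_interlaced_inj inj.
  by rewrite subr_eq0; apply: contra_neq ji => /inj ->.
have rw2 i j : rational_itv (fun t => cauchy_weight (l t) (m t) i / (l t i - m t j) ^+ 2).
  apply: rational_itvM; first exact: rw.
  apply: rational_itvV => [t t01|]; first by rewrite sqrf_eq0 d0.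
  by apply: rational_itvM; exact: rsub.
have re i j : rational_itv (fun t => cauchy_entry (l t) (m t) i j).
  apply: rational_itvM; first exact: rw2.
  apply: rational_itvV; first by move=> t /lm h; rewrite gt_eqF // cauchy_norm_gt0.
  by apply: rational_itv_sum => a _; exact: rw2.
have e0 i j t : 0 < t < 1 -> 0 <= cauchy_entry (l t) (m t) i j.
  move=> /lm h; rewrite divr_ge0 ?(ltW (cauchy_norm_gt0 h _)) //.
  by rewrite divr_ge0 ?sqr_ge0 // (ltW (cauchy_weight_gt0 h _)).
have sqV (i j : 'I_k) t : 0 < t < 1 ->
    (-1) ^+ (j < i)%N * Num.sqrt (cauchy_entry (l t) (m t) i j) *
    ((-1) ^+ (j < i)%N * Num.sqrt (cauchy_entry (l t) (m t) i j)) = cauchy_entry (l t) (m t) i j.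
  by move=> t01; rewrite mulrACA -expr2 sqrr_sign mul1r -expr2 sqr_sqrtr ?e0.
(* The entry is one term of the sum of squares of a unit row. *)
have e1 i j t : 0 < t < 1 -> cauchy_entry (l t) (m t) i j <= 1.
  move=> t01; rewrite -[leRHS]/(true%:R) -(eqxx i) -(cauchy_rows (lm t t01)).
  under eq_bigr do rewrite sqV //.
  by rewrite (bigD1 j) //= lerDl sumr_ge0 // => a _; exact: e0.
have lb (a b t : R) : 0 < t < 1 -> `|lerp a b t| <= `|a| + `|b|.
  move=> /andP[t0 t1]; rewrite /lerp (le_trans (ler_normD _ _)) // !normrM.
  rewrite (gtr0_norm t0) (gtr0_norm (_ : 0 < 1 - t)) ?subr_gt0 //.
  have := normr_ge0 a; have := normr_ge0 b; move: `|a| `|b| => x y x0 y0; nra.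
(* The defining product gives no bound, since its denominators may tend to [0]. The diagonal of
   [cauchy_diag] does: the weight is [l i] minus a combination of the [m a] with coefficients in
   [[0, 1]]. *)
have wb i t : 0 < t < 1 -> `|cauchy_weight (l t) (m t) i| <=
    (`|l0 i| + `|l1 i|) + \sum_a (`|m0 a| + `|m1 a|).
  move=> t01; have := cauchy_diag (lm t t01) i i; rewrite eqxx mulr1n.
  rewrite -expr2 sqr_sqrtr ?(ltW (cauchy_weight_gt0 (lm t t01) _)) // => e.
  have sub_of_add (x y z : R) : x + y = z -> y = z - x by move=> <-; ring.
  rewrite (sub_of_add _ _ _ e); apply: (le_trans (ler_normB _ _)).
  apply: lerD; first exact: lb.
  apply: (le_trans (ler_norm_sum _ _ _)); apply: ler_sum => a _.
  rewrite sqV // normrM (ger0_norm (e0 _ _ _ t01)).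
  by rewrite (le_trans _ (lb _ _ _ t01)) // ler_piMr // e1.
have /choice[W WP] : forall i, exists h : R -> R, continuous h /\
    forall t, 0 < t < 1 -> h t = cauchy_weight (l t) (m t) i.
  move=> i; have [h] := rational_itv_extend (rw i) (wb i); by exists h.
have /choice[E EP] : forall ij : 'I_k * 'I_k, exists h : R -> R, continuous h /\
    forall t, 0 < t < 1 -> h t = cauchy_entry (l t) (m t) ij.1 ij.2.
  move=> [i j]; have eb t : 0 < t < 1 -> `|cauchy_entry (l t) (m t) i j| <= 1.
    by move=> t01; rewrite ger0_norm ?e0 ?e1.
  by have [h] := rational_itv_extend (re i j) eb; exists h.
pose g i t := Num.sqrt (W i t).
pose V (i j : 'I_k) t : R := (-1) ^+ (j < i)%N * Num.sqrt (E (i, j) t).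
have gc i : continuous (g i) by apply: continuousR_sqrt; have [] := WP i.
have Vc i j : continuous (V i j).
  apply: continuousR_mul; first exact: cst_continuous.
  by apply: continuousR_sqrt; have [] := EP (i, j).
exists g, V; split=> // t t01; split=> i j.
- move: t t01; apply: (@eq_itv_closure _ (fun t => \sum_a V i a t * V j a t)).
  + by apply: continuousR_sum => a _; exact: continuousR_mul.
  + exact: cst_continuous.
  + move=> t t01; rewrite -(cauchy_rows (lm t t01)); apply: eq_bigr => a _.
    by rewrite /V (EP (i, a)).2 // (EP (j, a)).2.
- move: t t01.
  apply: (@eq_itv_closure _ (fun t => \sum_a m t a * (V i a t * V j a t) + g i t * g j t)).
  + apply: continuousR_add; last exact: continuousR_mul.
    apply: continuousR_sum => a _; apply: continuousR_mul; first exact: lerp_continuous.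
    exact: continuousR_mul.
  + by case: (i == j); [exact: lerp_continuous|exact: cst_continuous].
  + move=> t t01; rewrite -/(l t i) -(cauchy_diag (lm t t01)) /g !(WP _).2 //; congr (_ + _).
    by apply: eq_bigr => a _; rewrite /V (EP (i, a)).2 // (EP (j, a)).2.
Qed.

(** The condition on [i0] and [j0] says that the two deleted entries are neighbours in the
    interlacing chain. *)
Lemma interlaced_lift k (l m : 'I_k.+1 -> R) (i0 j0 : 'I_k.+1) :
  (j0 <= i0 <= j0.+1)%N -> interlaced l m ->
  interlaced (fun i => l (lift i0 i)) (fun j => m (lift j0 j)).
Proof.
move=> /andP[h1 h2] [A B]; split=> i j ij; [apply: A|apply: B]; move: ij h1 h2 => /=; rewrite /bump;
  by case: (leqP i0); case: (leqP j0); lia.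
Qed.

(* A pair with [l i = m j] at both ends stays equal along the segment and is split off as a fixed
   basis vector; without such a pair the interlacing is strict inside the segment. *)
Lemma rank_one_section k (l0 l1 m0 m1 : 'I_k -> R) :
  interlaced l0 m0 -> interlaced l1 m1 ->
  exists g V, rank_one_path (fun t i => lerp (l0 i) (l1 i) t) (fun t i => lerp (m0 i) (m1 i) t) g V.
Proof.
elim: k l0 l1 m0 m1 => [|k IH] l0 l1 m0 m1 I0 I1.
  by apply: strict_rank_one_section => // -[].
have [ne|] := pselect (forall i j, l0 i = m0 j -> l1 i <> m1 j).
  exact: strict_rank_one_section.
move=> /existsNP[p] /existsNP[q] /not_implyP[e0 /contrapT e1].
(* The coinciding entries need not be neighbours, but everything between them in the chain is
   squeezed to the same value, at both ends. An adjacent pair with the same indices at both ends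
   therefore exists. *)
have [i0 [j0 [h f0 f1]]] : exists i0 j0 : 'I_k.+1,
    [/\ (j0 <= i0 <= j0.+1)%N, l0 i0 = m0 j0 & l1 i0 = m1 j0].
  have [A0 B0] := I0; have [A1 B1] := I1.
  have [ij|ij|/val_inj ij] := ltngtP p q.
  - exists p, p; rewrite leqnn leqnSn; split=> //; apply/eqP; rewrite eq_le ?A0 ?A1 // andbT.
      by rewrite e0 (le_trans (A0 q q _)) ?B0.
    by rewrite e1 (le_trans (A1 q q _)) ?B1.
  - have hj : (q.+1 < k.+1)%N by rewrite (leq_ltn_trans ij).
    pose p' := Ordinal hj.
    have adj l m : interlaced l m -> l p = m q -> l p' = m q.
      move=> [A B] e; apply/eqP; rewrite eq_le B //= -e; case: (ltnP q.+1 p) => qp.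
        by rewrite (le_trans (B p' p qp)) ?A.
      by rewrite (_ : p = p') //; apply/val_inj/eqP; rewrite eqn_leq ij qp.
    exists p', q; rewrite /= leqnn leqnSn; split=> //; exact: adj.
  - by exists p, p; rewrite leqnn leqnSn; subst q.
have [g [V [gc Vc P]]] := IH _ _ _ _ (interlaced_lift h I0) (interlaced_lift h I1).
pose g' i t := if unlift i0 i is Some a then g a t else 0.
pose V' i j t : R := match unlift i0 i, unlift j0 j with
  | Some a, Some b => V a b t | None, None => 1 | _, _ => 0 end.
exists g', V'; split=> [a|a b|t /P[P1 P2]].
- rewrite /g'; case: unliftP => [c _|_]; [exact: gc|exact: cst_continuous].
- rewrite /V'; case: unliftP => [c _|_]; case: unliftP => [d _|_];
  by [exact: Vc|exact: cst_continuous].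
have Vj a : V' a j0 t = (a == i0)%:R.
  by rewrite /V' unlift_none; case: unliftP => [c ->|->]; rewrite ?lift_eqF ?eqxx.
have VjL a b : V' (lift i0 a) (lift j0 b) t = V a b t by rewrite /V' !liftK.
have VL0 b : V' i0 (lift j0 b) t = 0 by rewrite /V' unlift_none liftK.
split=> a b.
- rewrite (bigD1_ord j0) //= !Vj; case: (unliftP i0 a) => [c ->|->].
    case: (unliftP i0 b) => [d ->|->].
      rewrite !lift_eqF mul0r add0r (inj_eq lift_inj) -P1.
      by apply: eq_bigr => e _; rewrite !VjL.
    rewrite lift_eqF mul0r add0r big1 // => e _; by rewrite VL0 mulr0.
  rewrite eqxx mul1r big1 ?addr0 1?eq_sym // => e _; by rewrite VL0 mul0r.
- rewrite (bigD1_ord j0) //= !Vj /g'; case: (unliftP i0 a) => [c ->|->].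
    case: (unliftP i0 b) => [d ->|->].
      rewrite !lift_eqF mul0r mulr0 add0r (inj_eq lift_inj) -P2; congr (_ + _).
      by apply: eq_bigr => e _; rewrite !VjL.
    rewrite lift_eqF mul0r mulr0 add0r mulr0 addr0 big1 // => e _; by rewrite VL0 !mulr0.
  rewrite eqxx mul1r mul0r addr0 big1 ?addr0 => [|e _]; last by rewrite VL0 mul0r mulr0.
  by rewrite eq_sym mulr_natr f0 f1; case: eqP.
Qed.

End RankOneSection.

(** * Rank-one updates with prescribed spectrum *)

Local Open Scope sesquilinear_scope.

Section Transitivity.
Context {C : numClosedFieldType} (k : nat).
Implicit Types (l m : 'I_k -> C) (f : 'cV[C]_k).

(** Squared norm of the projection of [f] to the eigenspace of [diag l] for [a]; with repeated
    eigenvalues, the spectrum of a rank-one update determines only these norms, not the single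
    entries. *)
Definition block_norm l f (a : C) := \sum_(j | l j == a) `|f j 0| ^+ 2.

(** The bordered matrix with blocks [D], [-f], [g], [1] is made block triangular in two ways, by
    clearing [g] from the right and from the left; compare determinants. *)
Lemma det_diag_rank_one l (f : 'cV[C]_k) (g : 'rV[C]_k) : (forall i, l i != 0) ->
  \det (diag_mx (\row_i l i) + f *m g) = (\prod_i l i) * (1 + \sum_i f i 0 * g 0 i / l i).
Proof.
move=> l0; pose D := diag_mx (\row_i l i).
pose E := diag_mx (\row_i (l i)^-1).
have DE : D *m E = 1%:M.
  rewrite mulmx_diag; apply/matrixP => i j; rewrite !mxE; case: eqVneq => // ->.
  by rewrite mulfV.
have ED : E *m D = 1%:M by exact: mulmx1C.
have dD : \det D = \prod_i l i by rewrite det_diag; apply: eq_bigr => i _; rewrite mxE.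
have e1 : block_mx D (- f) g 1%:M *m block_mx 1%:M 0 (- g) 1%:M =
    block_mx (D + f *m g) (- f) 0 1%:M.
  by rewrite mulmx_block !mulmx0 !mulmx1 !mul1mx !add0r mulmxN mulNmx opprK subrr.
have e2 : block_mx 1%:M 0 (- (g *m E)) 1%:M *m block_mx D (- f) g 1%:M =
    block_mx D (- f) 0 (1%:M + g *m E *m f).
  rewrite mulmx_block !mul0mx !mul1mx !addr0 !mulNmx mulmxN opprK -(mulmxA g E D) ED mulmx1 addNr.
  by rewrite [_ + 1%:M]addrC.
have := congr1 determinant e2; rewrite det_mulmx det_lblock !det1 !mul1r det_ublock.
have := congr1 determinant e1; rewrite det_mulmx det_lblock !det1 !mulr1 det_ublock det1 mulr1.
move=> -> ->; rewrite dD; congr (_ * _).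
rewrite [X in \det X](mx11_scalar _) det_scalar1 !mxE eqxx; congr (_ + _).
by apply: eq_bigr => i _; rewrite mul_mx_diag !mxE mulrAC [g _ _ * _]mulrC.
Qed.

(* Clearing denominators gives a polynomial identity, which is then evaluated at [a]. *)
Lemma block_norm_rank_one l f f' :
  (forall x, (forall i, x != l i) ->
     \sum_i `|f i 0| ^+ 2 / (x - l i) = \sum_i `|f' i 0| ^+ 2 / (x - l i)) ->
  forall a, block_norm l f a = block_norm l f' a.
Proof.
move=> H a; pose c i := `|f i 0| ^+ 2 - `|f' i 0| ^+ 2.
(* Each distinct eigenvalue is listed once, so evaluating [p] at [a] kills exactly the terms with
   [l i != a]. *)
pose s := undup (map l (enum 'I_k)).
have ls i : l i \in s by rewrite mem_undup map_f // mem_enum.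
pose p := \sum_i c i *: \prod_(b <- s | b != l i) ('X - b%:P).
pose q := \prod_(b <- s) ('X - b%:P).
have pq0 x : (p * q).[x] = 0.
  rewrite hornerM; have [xs|xs] := boolP (x \in s).
    by rewrite [q.[_]]horner_prod (big_rem x) //= hornerXsubC subrr mul0r mulr0.
  have xl i : x != l i by apply: contraNneq xs => ->.
  suff -> : p.[x] = 0 by rewrite mul0r.
  have -> : p.[x] = (\sum_i c i / (x - l i)) * q.[x].
    rewrite horner_sum mulr_suml; apply: eq_bigr => i _; rewrite hornerZ -mulrA; congr (_ * _).
    rewrite [q.[_]]horner_prod (bigD1_seq (l i)) ?undup_uniq //= hornerXsubC.
    by rewrite mulKf ?subr_eq0 // horner_prod.
  suff -> : \sum_i c i / (x - l i) = 0 by rewrite mul0r.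
  by under eq_bigr do rewrite mulrBl; rewrite sumrB H // subrr.
have p0 : p = 0.
  have q0 : q != 0 by rewrite monic_neq0 // monic_prod_XsubC.
  apply/eqP; suff : p * q == 0 by rewrite mulf_eq0 (negbTE q0) orbF.
  (* The product vanishes everywhere; the natural numbers supply enough distinct roots. *)
  apply/eqP; apply: (@roots_geq_poly_eq0 _ _ (map (fun n => n%:R) (iota 0 (size (p * q))))).
  - by apply/allP => x _; rewrite /root pq0.
  - by rewrite map_inj_uniq ?iota_uniq // => x y /eqP; rewrite eqr_nat => /eqP.
  - by rewrite size_map size_iota.
have [[i0 a0]|na] := pselect (exists i, l i = a); last first.
  have l0 i : (l i == a) = false by apply/negP => /eqP e; apply: na; exists i.
  by rewrite /block_norm !big_pred0.
have sa : a \in s by rewrite -a0.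
pose P := \prod_(b <- s | b != a) (a - b).
have P0 : P != 0.
  rewrite prodf_seq_neq0; apply/allP => b _; apply/implyP => ba.
  by rewrite subr_eq0 eq_sym.
apply/eqP; rewrite -subr_eq0 /block_norm -sumrB; apply/eqP/(mulIf P0).
rewrite mul0r -[RHS](horner0 a) -[in RHS]p0 horner_sum.
rewrite [RHS](bigID (fun i => l i == a)) /= [X in _ + X]big1 ?addr0 => [|i ia].
  rewrite mulr_suml; apply: eq_bigr => i /eqP ->; rewrite hornerZ horner_prod; congr (_ * _).
  by apply: eq_bigr => b _; rewrite hornerXsubC.
rewrite hornerZ horner_prod (big_rem a) //= [a == _]eq_sym ia hornerXsubC subrr.
by rewrite mul0r mulr0.
Qed.

(* On each eigenspace of [diag l], with [u] and [v] the components of [f] and [f'] and [w = u - v],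
   take the complex reflection [1 - w w^* / (w^* u)]: it maps [u] to [v], and it is unitary because
   [u] and [v] have the same norm. If [w^* u = 0] then [w = 0], and division by [0] gives [0]. *)
Lemma unitary_block_norm l f f' :
  (forall a, block_norm l f a = block_norm l f' a) ->
  exists A : 'M[C]_k, [/\ A \is unitarymx, forall i j, l i != l j -> A i j = 0 & A *m f = f'].
Proof.
move=> nf.
pose w i := f i 0 - f' i 0.
pose z i := \sum_(j | l j == l i) (w j)^* * f j 0.
pose e i j : C := (l i == l j)%:R.
pose A : 'M[C]_k := \matrix_(i, j) ((i == j)%:R - e i j * (w i * (w j)^* / z i)).
(* Equality of the norms of [u] and [v] enters here: it makes twice the real part of [w^* u] equal
   to the squared norm of [w], which is what unitarity of the reflection requires. *)
have zE i : z i + (z i)^* = \sum_(j | l j == l i) w j * (w j)^*.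
  rewrite /z rmorph_sum -big_split /=.
  transitivity (\sum_(j | l j == l i) w j * (w j)^* + (block_norm l f (l i) - block_norm l f' (l i))).
    rewrite /block_norm -sumrB -big_split /=; apply: eq_bigr => j _.
    by rewrite rmorphM /= conjCK /w !normCK rmorphB /=; ring.
  by rewrite nf subrr addr0.
have w0 i : z i = 0 -> w i = 0.
  move=> zi; have := zE i; rewrite zi conjC0 addr0 => /esym/eqP.
  under eq_bigr do rewrite -normCK.
  rewrite psumr_eq0 => [/allP /(_ i)|j _]; last by rewrite exprn_ge0.
  by rewrite mem_index_enum eqxx sqrf_eq0 normr_eq0 => /(_ isT) /eqP.
exists A; split.
- apply/unitarymxP/matrixP => i j; rewrite !mxE.
  have [le|ne] := eqVneq (l i) (l j); last first.
    rewrite big1 => [|a _]; first by case: (i =P j) ne => [->|//]; rewrite eqxx.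
    rewrite !mxE /e; case: (eqVneq (l i) (l a)) => [ia|]; last first.
      by move=> ia; rewrite mul0r subr0; case: (i =P a) ia => [->|]; rewrite ?eqxx // mul0r.
    have ja : l j != l a by rewrite -ia eq_sym.
    rewrite (negbTE ja) mul0r subr0; case: (j =P a) ja => [->|_ _]; first by rewrite eqxx.
    by rewrite rmorph0 mulr0.
  have zij : z i = z j by rewrite /z le.
  have term a : A i a * (A ^t* ) a j = (i == a)%:R * (j == a)%:R
      - (j == a)%:R * (e i a * (w i * (w a)^* / z i))
      - (i == a)%:R * (e j a * ((w j)^* * w a / (z i)^*))
      + (l a == l i)%:R * (w a * (w a)^*) * (w i * (w j)^* / (z i * (z i)^*)).
    have cj (x y u v t : C) : (x - y * (u * v^* / t))^* = x^* - y^* * (u^* * v / t^*).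
      by rewrite rmorphB !rmorphM fmorphV /= conjCK.
    rewrite !mxE cj /e -le zij !conjC_nat.
    by rewrite [l a == _]eq_sym invfM; case: (l i == l a); rewrite ?mul1r ?mul0r; ring.
  have pick (x : 'I_k) (F : 'I_k -> C) : \sum_a (x == a)%:R * F a = F x.
    by rewrite (bigD1 x) //= eqxx mul1r big1 ?addr0 // => a ax; rewrite eq_sym (negbTE ax) mul0r.
  under eq_bigr do rewrite term.
  rewrite big_split /= !sumrB !pick /e -le eqxx !mul1r eq_sym -mulr_suml.
  have -> : \sum_a (l a == l i)%:R * (w a * (w a)^*) = z i + (z i)^*.
    rewrite zE [RHS]big_mkcond; apply: eq_bigr => a _.
    by case: (l a == l i); rewrite ?mul1r ?mul0r.
  have [z0|z0] := eqVneq (z i) 0.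
    by rewrite (w0 _ z0) !(mul0r, mulr0, subr0, addr0).
  have zc0 : (z i)^* != 0 by rewrite conjC_eq0.
  by field; rewrite ?z0 ?zc0.
- move=> i j ne; rewrite mxE /e (negbTE ne) mul0r subr0.
  by case: (i =P j) ne => [->|//]; rewrite eqxx.
- apply/matrixP => i j; rewrite ord1 mxE; under eq_bigr do rewrite mxE mulrBl.
  rewrite sumrB (bigD1 i) //= eqxx mul1r big1 ?addr0 => [|a ai]; last first.
    by rewrite eq_sym (negbTE ai) mul0r.
  suff -> : \sum_a e i a * (w i * (w a)^* / z i) * f a 0 = w i by rewrite /w subKr.
  transitivity (w i / z i * z i).
    rewrite {3}/z mulr_sumr [RHS]big_mkcond; apply: eq_bigr => a _.
    by rewrite /e eq_sym; case: (l a == l i); rewrite ?mul1r ?mul0r //; ring.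
  by have [z0|z0] := eqVneq (z i) 0; [rewrite (w0 _ z0) !mul0r|rewrite divfK].
Qed.
(* The characteristic polynomial of [diag l - f f^*] determines the rational function
   [\sum_i `|f i| ^+ 2 / (x - l i)]. *)
Lemma rank_one_block_norm l m (U U' : 'M[C]_k) f f' :
  U \is unitarymx -> U' \is unitarymx ->
  U *m diag_mx (\row_i m i) *m U^t* + f *m f^t* = diag_mx (\row_i l i) ->
  U' *m diag_mx (\row_i m i) *m U'^t* + f' *m f'^t* = diag_mx (\row_i l i) ->
  forall a, block_norm l f a = block_norm l f' a.
Proof.
move=> Uu Uu' E E'; apply: block_norm_rank_one => x xl.
have key V (g : 'cV[C]_k) : V \is unitarymx ->
    V *m diag_mx (\row_i m i) *m V^t* + g *m g^t* = diag_mx (\row_i l i) ->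
    \prod_i (x - m i) = (\prod_i (x - l i)) * (1 + \sum_i `|g i 0| ^+ 2 / (x - l i)).
  move=> Vu e; have /unitarymxP VV := Vu.
  transitivity (\det (diag_mx (\row_i (x - l i)) + g *m g^t*)); last first.
    have xl0 i : x - l i != 0 by rewrite subr_eq0.
    rewrite (det_diag_rank_one g (g^t*) xl0).
    by congr (_ * (1 + _)); apply: eq_bigr => i _; rewrite !mxE normCK.
  have -> : diag_mx (\row_i (x - l i)) + g *m g^t* =
      V *m diag_mx (\row_i (x - m i)) *m V^t*.
    have dB (d : 'I_k -> C) : diag_mx (\row_i (x - d i)) = x%:M - diag_mx (\row_i d i).
      by apply/matrixP => i j; rewrite !mxE mulrnBl.
    rewrite !dB -e mulmxBr mulmxBl mul_mx_scalar -scalemxAl VV scalemx1.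
    by rewrite opprD addrA addrNK.
  rewrite !det_mulmx mulrAC -det_mulmx VV det1 mul1r det_diag.
  by apply: eq_bigr => i _; rewrite mxE.
have := key _ _ Uu' E'; rewrite (key _ _ Uu E) => /mulfI h.
apply/(addrI 1)/h/prodf_neq0 => i _; by rewrite subr_eq0.
Qed.

End Transitivity.

(** * Interlacing *)

Local Open Scope complex_scope.

Section ComplexSpectra.
Context {R : realType}.
Local Notation C := R[i].

Definition real_diag k (l : 'I_k -> R) : 'M[C]_k := diag_mx (\row_i (l i)%:C).

Definition sorted_desc k (l : 'I_k -> R) := forall i j : 'I_k, (i <= j)%N -> l j <= l i.

Lemma real_diag_form k (l : 'I_k -> R) (v : 'rV[C]_k) :
  (v *m real_diag l *m v^t*) 0 0 = \sum_a (l a)%:C * `|v 0 a| ^+ 2.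
Proof.
rewrite mxE; apply: eq_bigr => a _; rewrite mul_mx_diag !mxE normCK.
by rewrite mulrCA mulrA.
Qed.

Lemma unit_form k (v : 'rV[C]_k) : (v *m v^t*) 0 0 = \sum_a `|v 0 a| ^+ 2.
Proof. by rewrite mxE; apply: eq_bigr => a _; rewrite !mxE normCK. Qed.

Lemma common_kernel k p q (A : 'M[C]_(k, p)) (B : 'M[C]_(k, q)) :
  (\rank A + \rank B < k)%N -> exists v : 'rV[C]_k, [/\ v != 0, v *m A = 0 & v *m B = 0].
Proof.
move=> h; have : kermx (row_mx A B) != 0.
  rewrite kermx_eq0 /row_free ltn_eqF // -mxrank_tr tr_row_mx.
  rewrite (leq_ltn_trans _ h) // -[in leqRHS](mxrank_tr A) -[in leqRHS](mxrank_tr B).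
  by rewrite -addsmxE; have [] := mxrank_adds_leqif A^T B^T.
move=> /rowV0Pn[v /sub_kermxP + v0]; rewrite mul_mx_row -[0 in RHS]row_mx0 => /eq_row_mx[vA vB].
by exists v.
Qed.

Lemma mulmx_pid k r (v : 'rV[C]_k) (a : 'I_k) :
  (v *m (pid_mx r : 'M[C]_k)) 0 a = (a < r)%:R * v 0 a.
Proof.
rewrite mxE (bigD1 a) //= big1 => [|b ba]; last first.
  rewrite mxE (_ : ((b : nat) == a) = false) ?mulr0 //; exact: negbTE.
by rewrite mxE eqxx addr0 mulrC.
Qed.

(* Courant-Fischer: compare the two quadratic forms on a vector common to an initial span of one
   eigenbasis and a final span of the other, orthogonal to [f] for the second inequality. *)
Lemma rank_one_interlaced k (l m : 'I_k -> R) (U : 'M[C]_k) (f : 'cV[C]_k) :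
  sorted_desc l -> sorted_desc m -> U \is unitarymx ->
  U *m real_diag m *m U^t* + f *m f^t* = real_diag l -> interlaced l m.
Proof.
move=> sl sm Uu E.
have UU : U *m U^t* = 1%:M by apply/unitarymxP.
have Nv (v : 'rV[C]_k) : \sum_a `|(v *m U) 0 a| ^+ 2 = \sum_a `|v 0 a| ^+ 2.
  by rewrite -!unit_form trmx_mul map_mxM /= mulmxA -(mulmxA v) UU mulmx1.
have N0 (v : 'rV[C]_k) : v != 0 -> 0 < \sum_a `|v 0 a| ^+ 2.
  move=> v0; rewrite lt_def sumr_ge0 ?andbT => [|a _]; last by rewrite exprn_ge0.
  apply: contra v0; rewrite psumr_eq0 => [/allP h|a _]; last by rewrite exprn_ge0.
  apply/eqP/rowP => a; have := h a; rewrite mem_index_enum sqrf_eq0 normr_eq0 mxE.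
  by move=> /(_ isT) /eqP.
have form (v : 'rV[C]_k) : \sum_a (l a)%:C * `|v 0 a| ^+ 2 =
    \sum_a (m a)%:C * `|(v *m U) 0 a| ^+ 2 + `|(v *m f) 0 0| ^+ 2.
  rewrite -!real_diag_form -E mulmxDr mulmxDl mxE; congr (_ + _).
    by rewrite trmx_mul map_mxM !mulmxA.
  rewrite mulmxA -mulmxA -map_mxM -trmx_mul [LHS]mxE big_ord1 !mxE normCK.
  done.
have bnd (x : R) (d : 'I_k -> R) (v : 'rV[C]_k) :
    (forall a, v 0 a = 0 \/ d a <= x) ->
    \sum_a (d a)%:C * `|v 0 a| ^+ 2 <= x%:C * \sum_a `|v 0 a| ^+ 2.
  move=> h; rewrite mulr_sumr; apply: ler_sum => a _.
  by case: (h a) => [->|dx]; [rewrite normr0 expr0n !mulr0|rewrite ler_wpM2r ?exprn_ge0 // lecR].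
have bnd' (x : R) (d : 'I_k -> R) (v : 'rV[C]_k) :
    (forall a, v 0 a = 0 \/ x <= d a) ->
    x%:C * \sum_a `|v 0 a| ^+ 2 <= \sum_a (d a)%:C * `|v 0 a| ^+ 2.
  move=> h; rewrite mulr_sumr; apply: ler_sum => a _.
  by case: (h a) => [->|dx]; [rewrite normr0 expr0n !mulr0|rewrite ler_wpM2r ?exprn_ge0 // lecR].
have low (v : 'rV[C]_k) r : v *m (pid_mx r : 'M[C]_k) = 0 -> forall a : 'I_k, (a < r)%N -> v 0 a = 0.
  by move=> /rowP h a ar; have := h a; rewrite mulmx_pid ar mul1r mxE.
have high (v : 'rV[C]_k) r : v *m (copid_mx r : 'M[C]_k) = 0 -> forall a : 'I_k, (r <= a)%N -> v 0 a = 0.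
  move=> h a ar; have -> : v = v *m pid_mx r.
    by apply/eqP; rewrite -subr_eq0 -{1}[v]mulmx1 -mulmxBr; apply/eqP.
  by rewrite mulmx_pid ltnNge ar mul0r.
split=> i j ij.
(* The vector [v] vanishes below index [i] and [v *m U] above index [j]. These are at most
   [i + (k - j - 1)] conditions, fewer than [k] because [i <= j]. *)
- have [v [v0 vA vB]] : exists v : 'rV[C]_k,
      [/\ v != 0, v *m (pid_mx i : 'M[C]_k) = 0 & v *m (U *m (copid_mx j.+1 : 'M[C]_k)) = 0].
    apply: common_kernel; rewrite (leq_ltn_trans (leq_add (leqnn _) (mxrankM_maxr _ _))) //.
    rewrite rank_pid_mx ?(ltnW (ltn_ord _)) // rank_copid_mx //.
    have := ltn_ord j; lia.
  rewrite mulmxA in vB.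
  rewrite -lecR -(ler_pM2r (N0 v v0)) -{1}Nv.
  apply: (le_trans (bnd' _ m _ _)) => [a|].
    by case: (leqP a j) => aj; [right; apply: sm|left; apply: (high _ _ vB)].
  apply: le_trans (bnd _ l _ _) => [|a]; first by rewrite form lerDl exprn_ge0.
  by case: (leqP i a) => ai; [right; apply: sl|left; apply: (low _ _ vA)].
(* The roles are exchanged. Orthogonality to [f] costs one more condition, and [i < j] pays for
   it. *)
- have [v [v0 vA vB]] : exists v : 'rV[C]_k,
      [/\ v != 0, v *m (copid_mx j.+1 : 'M[C]_k) = 0 &
          v *m (row_mx (U *m (pid_mx i : 'M[C]_k)) f) = 0].
    apply: common_kernel.
    have r1 : (\rank (row_mx (U *m (pid_mx i : 'M[C]_k)) f) <= i + 1)%N.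
      rewrite -mxrank_tr tr_row_mx -addsmxE (leq_trans (mxrank_adds_leqif _ _)) // !mxrank_tr.
      apply: leq_add; last exact: rank_leq_col.
      by rewrite (leq_trans (mxrankM_maxr _ _)) // rank_pid_mx ?(ltnW (ltn_ord _)).
    rewrite (leq_ltn_trans (leq_add (leqnn _) r1)) // rank_copid_mx //.
    have := ltn_ord j; lia.
  move: vB; rewrite mul_mx_row -[0 in RHS]row_mx0 => /eq_row_mx[+ vf]; rewrite mulmxA => vB.
  rewrite -lecR -(ler_pM2r (N0 v v0)) -{2}Nv.
  apply: (le_trans (bnd' _ l _ _)) => [a|].
    by case: (leqP a j) => aj; [right; apply: sl|left; apply: (high _ _ vA)].
  apply: le_trans (bnd _ m _ _) => [|a].
    by rewrite form vf mxE normr0 expr0n addr0.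
  by case: (leqP i a) => ai; [right; apply: sm|left; apply: (low _ _ vB)].
Qed.

End ComplexSpectra.

(** * Complex paths *)

Section ComplexPaths.
Context {R : realType}.
Local Notation C := R[i].

(** The descending order makes spectra of different operators comparable index by index, as
    interlacing and interpolation require. *)
Lemma hermitian_sorted_spectral k (H : 'M[C]_k) : H \is hermsymmx ->
  exists l (U : 'M[C]_k), [/\ sorted_desc l, U \is unitarymx & H = U *m real_diag l *m U^t*].
Proof.
move=> Hh; have /hermitian_normalmx /orthomx_spectralP HE := Hh.
have Pu := spectral_unitarymx H; move: HE; rewrite invmx_unitary //.
have := hermitian_spectral_diag_real Hh.
move: (spectralmx H) (spectral_diag H) Pu => P sp Pu /mxOverP spr HE.
pose l i := complex.Re (sp 0 i).
have lE i : sp 0 i = (l i)%:C by rewrite /l RRe_real.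
pose t := [tuple l i | i < k].
have st : size (sort >=%R t) == k by rewrite size_sort size_tuple.
have /tuple_permP[s sE] : perm_eq (Tuple st) t by rewrite /= perm_sort.
pose U : 'M[C]_k := col_perm s (P^t*).
exists (fun i => l (s i)), U; split.
- move=> i j ij; have srt : sorted >=%R (Tuple st) by apply: sort_sorted; move=> x y; exact: ge_total.
  have e (a : 'I_k) : l (s a) = nth 0 (Tuple st) a.
    rewrite sE (nth_map a) ?size_enum_ord // nth_ord_enum tnth_mktuple //.
  rewrite !e; apply: (sorted_leq_nth _ _ _ srt) => //; first by move=> x y z /= h1 h2; exact: le_trans h2 h1.
  + by move=> x; exact: lexx.
  + by rewrite inE size_tuple.
  + by rewrite inE size_tuple.
- apply/unitarymxP/matrixP => i j; rewrite !mxE.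
  have : (P^t* *m P) = 1%:M by apply: mulmx1C; apply/unitarymxP.
  move=> /matrixP/(_ i j); rewrite !mxE => <-.
  rewrite [RHS](reindex_inj (@perm_inj _ s)) /=; apply: eq_bigr => a _.
  by rewrite !mxE conjCK.
- rewrite {1}HE; apply/matrixP => i j; rewrite !mxE.
  rewrite (reindex_inj (@perm_inj _ s)) /=; apply: eq_bigr => a _.
  by rewrite !mul_mx_diag !mxE conjCK lE.
Qed.

(** Continuity by real and imaginary parts reduces everything to real functions; the topology of
    matrices appears only in [mxcont_continuous]. *)
Definition ccont (h : R -> C) :=
  continuous (fun t => complex.Re (h t)) /\ continuous (fun t => complex.Im (h t)).

Lemma ccont_cst (a : C) : ccont (fun=> a).
Proof. by split; exact: cst_continuous. Qed.

Lemma ccont_real (h : R -> R) : continuous h -> ccont (fun t => (h t)%:C).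
Proof. by move=> hc; split => //=; exact: cst_continuous. Qed.

Lemma ccontD (h g : R -> C) : ccont h -> ccont g -> ccont (fun t => h t + g t).
Proof.
move=> [a b] [c d]; split.
  rewrite (_ : (fun t => _) = fun t => complex.Re (h t) + complex.Re (g t)).
    exact: continuousR_add.
  by apply/funext => t; rewrite raddfD.
rewrite (_ : (fun t => _) = fun t => complex.Im (h t) + complex.Im (g t)).
  exact: continuousR_add.
by apply/funext => t; rewrite raddfD.
Qed.

Lemma ccontM (h g : R -> C) : ccont h -> ccont g -> ccont (fun t => h t * g t).
Proof.
move=> [a b] [c d]; split.
  rewrite (_ : (fun t => _) = fun t =>
      complex.Re (h t) * complex.Re (g t) + - (complex.Im (h t) * complex.Im (g t))).
    apply: continuousR_add; last apply: continuousR_opp; exact: continuousR_mul.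
  by apply/funext => t; case: (h t); case: (g t).
rewrite (_ : (fun t => _) = fun t =>
      complex.Re (h t) * complex.Im (g t) + complex.Im (h t) * complex.Re (g t)).
  by apply: continuousR_add; exact: continuousR_mul.
by apply/funext => t; case: (h t); case: (g t).
Qed.

Lemma ccont_comp (h : R -> C) (s : R -> R) : ccont h -> continuous s -> ccont (fun t => h (s t)).
Proof.
by move=> [a b] sc; split; [exact: (continuousR_comp a sc)|exact: (continuousR_comp b sc)].
Qed.

Lemma ccont_sum n (F : 'I_n -> R -> C) :
  (forall i, ccont (F i)) -> ccont (fun t => \sum_i F i t).
Proof.
elim: n F => [|n IH] F Fc.
  rewrite (_ : (fun t => _) = fun=> 0); first exact: ccont_cst.
  by apply/funext => t; rewrite big_ord0.
rewrite (_ : (fun t => _) = fun t => F ord0 t + \sum_i F (lift ord0 i) t).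
  by apply: ccontD => //; apply: IH.
by apply/funext => t; rewrite big_ord_recl.
Qed.

Definition mxcont m n (M : R -> 'M[C]_(m, n)) := forall i j, ccont (fun t => M t i j).

Lemma mxcont_eq m n (M : R -> 'M[C]_(m, n)) (F : 'I_m -> 'I_n -> R -> C) :
  (forall i j, ccont (F i j)) -> (forall i j t, M t i j = F i j t) -> mxcont M.
Proof.
move=> Fc e i j; rewrite (_ : (fun t => _) = F i j) //.
by apply/funext => t.
Qed.

Lemma mxcont_cst m n (A : 'M[C]_(m, n)) : mxcont (fun=> A).
Proof. by move=> i j; exact: ccont_cst. Qed.

Lemma mxcont_mul m n p (A : R -> 'M[C]_(m, n)) (B : R -> 'M[C]_(n, p)) :
  mxcont A -> mxcont B -> mxcont (fun t => A t *m B t).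
Proof.
move=> Ac Bc; apply: (mxcont_eq (F := fun i j t => \sum_a A t i a * B t a j)) => [i j|i j t].
  by apply: ccont_sum => a; exact: ccontM.
by rewrite mxE.
Qed.

Lemma mxcont_row_mx m n p (A : R -> 'M[C]_(m, n)) (B : R -> 'M[C]_(m, p)) :
  mxcont A -> mxcont B -> mxcont (fun t => row_mx (A t) (B t)).
Proof.
move=> Ac Bc; apply: (mxcont_eq (F := fun i j t =>
  match fintype.split j with inl a => A t i a | inr a => B t i a end)) => [i j|i j t].
  by case: fintype.split => a; [exact: Ac|exact: Bc].
by rewrite mxE.
Qed.

Lemma mxcont_comp m n (A : R -> 'M[C]_(m, n)) (s : R -> R) :
  mxcont A -> continuous s -> mxcont (fun t => A (s t)).
Proof. by move=> Ac sc i j; exact: (ccont_comp (Ac i j) sc). Qed.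

Lemma mxcontD m n (A B : R -> 'M[C]_(m, n)) :
  mxcont A -> mxcont B -> mxcont (fun t => A t + B t).
Proof.
move=> Ac Bc; apply: (mxcont_eq (F := fun i j t => A t i j + B t i j)) => [i j|i j t].
  exact: ccontD.
by rewrite mxE.
Qed.

(* For a square root [w] of [u] other than [-1], the segment from [1] to [w] avoids [0];
   the path is [z / conj z] along it. *)
Lemma circle_path (u : C) : exists h : R -> C, `|u| = 1 ->
  [/\ ccont h, h 0 = 1, h 1 = u & forall t, `|h t| = 1].
Proof.
have [u1|nu] := pselect (`|u| = 1); last by exists (fun=> 1).
pose w0 := sqrtC u; pose w := if w0 == -1 then 1 else w0.
have w2 : w * w = u.
  rewrite /w; case: eqP => [e|_]; last by rewrite -expr2 sqrtCK.
  by rewrite mulr1 -(sqrtCK u) -/w0 e sqrrN expr1n.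
have w1 : `|w| ^+ 2 = 1 by rewrite -normrX expr2 w2.
have wN : w <> -1.
  rewrite /w; case: eqP => // _ /eqP; rewrite -subr_eq0 opprK.
  by rewrite -[1 + 1]/(2%:R) pnatr_eq0.
case wE : w w1 w2 wN => [a b] w1 w2 wN.
have ab : a * a + b * b = 1.
  by move: w1; rewrite -add_Re2_Im2 /= => -[]; rewrite !expr2.
have aN : b = 0 -> a <> -1 by move=> b0 aN; apply: wN; apply/eqP; rewrite b0 aN eq_complex /= oppr0 !eqxx.
pose A t : R := (1 - clamp t) * 1 + clamp t * a; pose B t : R := clamp t * b.
pose N t : R := A t * A t + B t * B t.
have N0 t : N t != 0.
  rewrite /N; apply/eqP => e; have /andP[s0 s1] := clamp_itv t.
  have B0 : B t = 0 by nra.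
  have A0 : A t = 0 by nra.
  move: A0 B0; rewrite /A /B; move: (clamp t) s0 s1 => s s0 s1 A0 /eqP.
  rewrite mulf_eq0 => /orP[/eqP sz|/eqP bz]; first by move: A0; rewrite sz; lra.
  have := aN bz; have : (a - 1) * (a + 1) = 0 by rewrite bz in ab; nra.
  move=> /eqP; rewrite mulf_eq0 => /orP[/eqP h|/eqP h]; last by move=> []; lra.
  have a1 : a = 1 by lra.
  by move: A0; rewrite a1; lra.
have Ac : continuous A.
  exact: (continuousR_comp (@lerp_continuous _ 1 a) clamp_continuous).
have Bc : continuous B by apply: continuousR_mul; [exact: clamp_continuous|exact: cst_continuous].
have Nc : continuous N by apply: continuousR_add; exact: continuousR_mul.
exists (fun t => ((A t * A t + - (B t * B t)) / N t) +i* ((A t * B t + A t * B t) / N t)).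
move=> _; split.
- split=> /=; apply: continuousR_mul; try exact: continuousR_inv.
    apply: continuousR_add; last apply: continuousR_opp; exact: continuousR_mul.
  by apply: continuousR_add; exact: continuousR_mul.
- have [A0 B0] : A 0 = 1 /\ B 0 = 0 by rewrite /A /B clamp_le0 //; split; ring.
  by rewrite /N A0 B0 !(mulr0, mulr1, oppr0, addr0, divr1, mul0r).
- have [A1 B1] : A 1 = a /\ B 1 = b by rewrite /A /B clamp_ge1 //; split; ring.
  rewrite /N A1 B1 ab !divr1 -w2; congr (_ +i* _); ring.
- move=> t; rewrite normc_def /= -[RHS]/(1%:C); congr (_%:C).
  rewrite (_ : _ + _ = 1) ?sqrtr1 //; have := N0 t; rewrite /N; move: (A t) (B t) => x y xy.
  by field.
Qed.

End ComplexPaths.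

(** * Unitary matrices and paths *)

Section UnitaryAlgebra.
Context {C : numClosedFieldType}.

Lemma adj_mul m n p (A : 'M[C]_(m, n)) (B : 'M[C]_(n, p)) : (A *m B)^t* = B^t* *m A^t*.
Proof. by rewrite trmx_mul map_mxM. Qed.

Lemma unitary_adjl n (U : 'M[C]_n) : U \is unitarymx -> U^t* *m U = 1%:M.
Proof. by move=> /unitarymxP /mulmx1C. Qed.

Lemma unitary_adjr n (U : 'M[C]_n) : U \is unitarymx -> U *m U^t* = 1%:M.
Proof. by move=> /unitarymxP. Qed.

Lemma adj_unitary n (U : 'M[C]_n) : U \is unitarymx -> U^t* \is unitarymx.
Proof. by rewrite trmxC_unitary. Qed.

Lemma diag_unitary n (u : 'rV[C]_n) :
  (diag_mx u \is unitarymx) = [forall i, `|u 0 i| == 1].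
Proof.
have e : diag_mx u *m (diag_mx u)^t* = diag_mx (\row_i `|u 0 i| ^+ 2).
  rewrite tr_diag_mx map_diag_mx mulmx_diag; congr diag_mx.
  by apply/rowP => i; rewrite !mxE normCK.
apply/unitarymxP/forallP => [|h].
  rewrite e => /matrixP h i; have /eqP := h i i; rewrite !mxE eqxx mulr1n.
  by rewrite sqrp_eq1.
rewrite e; apply/matrixP => i j; rewrite !mxE; case: eqVneq => // ->.
by rewrite (eqP (h j)) expr1n.
Qed.

(** Commuting with [diag_mx u] means that [K i j] vanishes unless [u 0 i = u 0 j], a pattern that
    survives applying [g] to the entries of [u]. *)
Lemma diag_commute_map n (u : 'rV[C]_n) (K : 'M[C]_n) (g : C -> C) :
  diag_mx u *m K = K *m diag_mx u ->
  diag_mx (\row_i g (u 0 i)) *m K = K *m diag_mx (\row_i g (u 0 i)).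
Proof.
move=> /matrixP e; apply/matrixP => i j; have := e i j.
rewrite !mul_mx_diag !mul_diag_mx !mxE => {}e.
have [->|uij] := eqVneq (u 0 i) (u 0 j); first by rewrite mulrC.
suff -> : K i j = 0 by rewrite mulr0 mul0r.
apply/eqP; have /eqP : (u 0 i - u 0 j) * K i j = 0 by rewrite mulrBl e mulrC subrr.
by rewrite mulf_eq0 subr_eq0 (negbTE uij).
Qed.

Lemma conjugate_mul n (P X Y : 'M[C]_n) : P \is unitarymx ->
  P^t* *m X *m P *m (P^t* *m Y *m P) = P^t* *m (X *m Y) *m P.
Proof. by move=> Pu; rewrite !mulmxA -(mulmxA _ P (P^t*)) unitary_adjr // mulmx1. Qed.

Lemma conjugateK n (P X : 'M[C]_n) : P \is unitarymx ->
  P^t* *m (P *m X *m P^t*) *m P = X.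
Proof.
by move=> Pu; rewrite !mulmxA unitary_adjl // mul1mx -mulmxA unitary_adjl // mulmx1.
Qed.

(** Only [U] is diagonalized; in its eigenbasis [D] becomes some [K], not necessarily diagonal, that
    commutes with the eigenvalue matrix. *)
Lemma unitary_spectral n (U D : 'M[C]_n) : U \is unitarymx -> U *m D = D *m U ->
  exists (P K : 'M[C]_n) (u : 'rV[C]_n), [/\ P \is unitarymx, U = P^t* *m diag_mx u *m P,
    D = P^t* *m K *m P, forall i, `|u 0 i| = 1 & diag_mx u *m K = K *m diag_mx u].
Proof.
move=> Uu UD; have Un : U \is normalmx.
  by apply/normalmxP; rewrite unitary_adjl // unitary_adjr.
have Pu := spectral_unitarymx U; move/orthomx_spectralP: Un; rewrite invmx_unitary //.
move: (spectralmx U) (spectral_diag U) Pu => P u Pu UE.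
have Pu' := adj_unitary Pu.
have uE : diag_mx u = P *m U *m P^t*.
  by rewrite UE; have := conjugateK (diag_mx u) Pu'; rewrite trmxCK => ->.
exists P, (P *m D *m P^t*), u; split=> //; first by rewrite conjugateK.
  move=> i; have : diag_mx u \is unitarymx.
    by rewrite uE; exact: (mul_unitarymx (mul_unitarymx Pu Uu) Pu').
  by rewrite diag_unitary => /forallP/(_ i)/eqP.
have cm X Y : P *m X *m P^t* *m (P *m Y *m P^t*) = P *m (X *m Y) *m P^t*.
  by have := conjugate_mul X Y Pu'; rewrite trmxCK.
by rewrite uE !cm UD.
Qed.

(** Conjugating the first equation by [A] and cancelling [g g^*] shows that [A U] and [W] conjugate
    [Dm] to the same matrix; hence [(A U)^* W] commutes with [Dm]. *)
Lemma rank_one_commutant n (U W A Dl Dm : 'M[C]_n) (f g : 'cV[C]_n) :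
  U \is unitarymx -> W \is unitarymx -> A \is unitarymx ->
  U *m Dm *m U^t* + f *m f^t* = Dl -> W *m Dm *m W^t* + g *m g^t* = Dl ->
  A *m Dl = Dl *m A -> A *m f = g ->
  exists B : 'M[C]_n, [/\ B \is unitarymx, A *m U *m B = W & B *m Dm = Dm *m B].
Proof.
move=> Uu Wu Au EU EW AD Af.
have UU := unitary_adjl Uu; have UU' := unitary_adjr Uu.
have AA := unitary_adjl Au; have AA' := unitary_adjr Au; have WW := unitary_adjl Wu.
have key : A *m U *m Dm *m U^t* *m A^t* = W *m Dm *m W^t*.
  apply: (addIr (g *m g^t*)); rewrite EW -Af adj_mul.
  have -> : Dl = A *m Dl *m A^t* by rewrite AD -mulmxA AA' mulmx1.
  by rewrite -EU mulmxDr mulmxDl !mulmxA.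
exists (U^t* *m A^t* *m W); split.
- exact: (mul_unitarymx (mul_unitarymx (adj_unitary Uu) (adj_unitary Au)) Wu).
- by rewrite !mulmxA -(mulmxA A) UU' mulmx1 AA' mul1mx.
have e : W *m Dm = A *m U *m Dm *m U^t* *m A^t* *m W.
  by rewrite key -(mulmxA _ (W^t*) W) WW mulmx1.
by rewrite -[LHS]mulmxA e !mulmxA -(mulmxA (U^t*) (A^t*)) AA mulmx1 UU mul1mx.
Qed.

Lemma rank_one_move n (U A B Dl Dm : 'M[C]_n) (f : 'cV[C]_n) :
  A \is unitarymx -> B \is unitarymx -> U *m Dm *m U^t* + f *m f^t* = Dl ->
  A *m Dl = Dl *m A -> B *m Dm = Dm *m B ->
  A *m U *m B *m Dm *m (A *m U *m B)^t* + (A *m f) *m (A *m f)^t* = Dl.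
Proof.
move=> Au Bu E AD BD; rewrite !adj_mul -(mulmxA _ B Dm) BD.
rewrite !mulmxA -(mulmxA _ B (B^t*)) unitary_adjr // mulmx1.
rewrite -[RHS]mulmx1 -(unitary_adjr Au) [RHS]mulmxA -AD -E.
by rewrite mulmxDr mulmxDl !mulmxA.
Qed.

Definition colsq k N (F : 'M[C]_(k, N)) (j : 'I_N) : C := (F^t* *m F) j j.

Lemma colsqE k N (F : 'M[C]_(k, N)) j : colsq F j = \sum_i `|F i j| ^+ 2.
Proof.
by rewrite /colsq mxE; apply: eq_bigr => i _; rewrite !mxE normCK mulrC.
Qed.

Lemma colsq_unitary k N (U : 'M[C]_k) (F : 'M[C]_(k, N)) j :
  U \is unitarymx -> colsq (U *m F) j = colsq F j.
Proof.
by move=> Uu; rewrite /colsq adj_mul mulmxA -(mulmxA (F^t*)) unitary_adjl // mulmx1.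
Qed.

Lemma colsq_row_mx k N (f : 'cV[C]_k) (F : 'M[C]_(k, N)) (j : 'I_(1 + N)) :
  colsq (row_mx f F) j = match fintype.split j with inl a => colsq f a | inr b => colsq F b end.
Proof.
rewrite colsqE; case: fintype.splitP => a ja.
  rewrite colsqE; apply: eq_bigr => i _.
  by rewrite (_ : j = lshift N a) ?row_mxEl //; exact: val_inj.
rewrite colsqE; apply: eq_bigr => i _.
by rewrite (_ : j = rshift 1 a) ?row_mxEr //; exact: val_inj.
Qed.

(** This is why prescribed column norms become linear conditions on the spectra. *)
Lemma rank_one_colsq n (U Dl Dm : 'M[C]_n) (f : 'cV[C]_n) j :
  U \is unitarymx -> U *m Dm *m U^t* + f *m f^t* = Dl ->
  colsq f j = \tr Dl - \tr Dm.
Proof.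
move=> Uu <-; rewrite mxtraceD mxtrace_mulC mulmxA unitary_adjl // mul1mx addrAC subrr add0r.
by rewrite mxtrace_mulC ord1 /mxtrace big_ord1.
Qed.

Lemma row_mx_adj k N (f : 'cV[C]_k) (G : 'M[C]_(k, N)) :
  row_mx f G *m (row_mx f G)^t* = G *m G^t* + f *m f^t*.
Proof. by rewrite tr_row_mx map_col_mx mul_row_col addrC. Qed.

End UnitaryAlgebra.

Section UnitaryPaths.
Context {R : realType}.
Local Notation C := R[i].

Lemma unitary_commutant_path k (U D : 'M[C]_k) : U \is unitarymx -> U *m D = D *m U ->
  exists A : R -> 'M[C]_k, [/\ mxcont A, A 0 = 1%:M, A 1 = U,
    forall t, A t \is unitarymx & forall t, A t *m D = D *m A t].
Proof.
move=> Uu UD; have [P [K [u [Pu UE DE u1 Ku]]]] := unitary_spectral Uu UD.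
(* The path is chosen as a function of the eigenvalue alone, so equal eigenvalues move together and
   commutation with [K] persists. *)
have /choice[h hP] := @circle_path R.
pose d t : 'rV[C]_k := \row_i h (u 0 i) t.
have dU t : diag_mx (d t) \is unitarymx.
  by rewrite diag_unitary; apply/forallP => i; rewrite mxE; have [_ _ _ ->] := hP _ (u1 i).
have Kd t : diag_mx (d t) *m K = K *m diag_mx (d t).
  exact: (diag_commute_map (h ^~ t) Ku).
exists (fun t => P^t* *m diag_mx (d t) *m P); split.
- apply: mxcont_mul; last exact: mxcont_cst.
  apply: mxcont_mul; first exact: mxcont_cst.
  apply: (mxcont_eq (F := fun i j t => h (u 0 i) t *+ (i == j))) => [i j|i j t].
    case: (i == j); last exact: ccont_cst.
    by have [] := hP _ (u1 i).
  by rewrite !mxE.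
- have -> : d 0 = const_mx 1.
    by apply/rowP => i; rewrite !mxE; have [] := hP _ (u1 i).
  by rewrite diag_const_mx mulmx1 (unitary_adjl Pu).
- have -> : d 1 = u by apply/rowP => i; rewrite !mxE; have [] := hP _ (u1 i).
  by rewrite -UE.
- move=> t; exact: (mul_unitarymx (mul_unitarymx (adj_unitary Pu) (dU t)) Pu).
- move=> t; move: (diag_mx (d t)) (Kd t) => e eK.
  have := conjugate_mul e K Pu; rewrite -DE => ->.
  by have := conjugate_mul K e Pu; rewrite -DE eK => ->.
Qed.

Lemma rank_one_fiber_path k (l m : 'I_k -> R) (U W : 'M[C]_k) (f g : 'cV[C]_k) :
  U \is unitarymx -> W \is unitarymx ->
  U *m real_diag m *m U^t* + f *m f^t* = real_diag l ->
  W *m real_diag m *m W^t* + g *m g^t* = real_diag l ->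
  exists (V : R -> 'M[C]_k) (v : R -> 'cV[C]_k),
    [/\ mxcont V, mxcont v, (V 0, v 0) = (U, f), (V 1, v 1) = (W, g) &
     forall t, V t \is unitarymx /\ V t *m real_diag m *m (V t)^t* + v t *m (v t)^t* = real_diag l].
Proof.
move=> Uu Wu EU EW.
have [A [Au Al Af]] := unitary_block_norm (rank_one_block_norm Uu Wu EU EW).
have AD : A *m real_diag l = real_diag l *m A.
  apply/matrixP => i j; rewrite mul_mx_diag mul_diag_mx !mxE.
  have [e|ne] := eqVneq (l i)%:C (l j)%:C; first by rewrite e mulrC.
  by rewrite Al // mulr0 mul0r.
have [B [Bu AUB BD]] := rank_one_commutant Uu Wu Au EU EW AD Af.
have [a [ac a0 a1 au aD]] := unitary_commutant_path Au AD.
have [b [bc b0 b1 bu bD]] := unitary_commutant_path Bu BD.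
exists (fun t => a t *m U *m b t), (fun t => a t *m f); split.
- by apply: mxcont_mul => //; apply: mxcont_mul => //; exact: mxcont_cst.
- by apply: mxcont_mul => //; exact: mxcont_cst.
- by rewrite a0 b0 !mul1mx mulmx1.
- by rewrite a1 b1 AUB Af.
- move=> t; split; first exact: (mul_unitarymx (mul_unitarymx (au t) Uu) (bu t)).
  exact: (rank_one_move (au t) (bu t) EU (aD t) (bD t)).
Qed.

Lemma real_diag_trace k (l : 'I_k -> R) : \tr (real_diag l) = (\sum_i l i)%:C.
Proof. by rewrite mxtrace_diag rmorph_sum; apply: eq_bigr => i _; rewrite mxE. Qed.

End UnitaryPaths.

(** * Frames over a segment of spectra *)

Section FrameSpaces.
Context {R : realType}.
Local Notation C := R[i].

(* Paths carry a parameter [s], so that a segment of spectra can be traversed with pauses at its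
   ends, during which the frame moves in a fiber. *)
Definition joined k N (X : R -> 'M[C]_(k, N) -> Prop) (p q : R * 'M[C]_(k, N)) :=
  exists (s : R -> R) (F : R -> 'M[C]_(k, N)),
    [/\ continuous s, mxcont F, (s 0, F 0) = p, (s 1, F 1) = q &
     forall t, 0 <= t <= 1 -> X (s t) (F t)].

Lemma joined_trans k N (X : R -> 'M[C]_(k, N) -> Prop) p q r :
  joined X p q -> joined X q r -> joined X p r.
Proof.
move=> [s [F [sc Fc e0 e1 H]]] [s' [F' [sc' Fc' e0' e1' H']]].
have [ss FF] : s' 0 = s 1 /\ F' 0 = F 1 by move: e0'; rewrite -e1 => -[].
pose a (t : R) := clamp (2 * t); pose b (t : R) := clamp (2 * t - 1).
have ac : continuous a.
  apply: (continuousR_comp clamp_continuous).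
  by apply: continuousR_mul; [exact: cst_continuous|exact: continuousR_id].
have bc : continuous b.
  apply: (continuousR_comp clamp_continuous); apply: continuousR_add; last exact: cst_continuous.
  by apply: continuousR_mul; [exact: cst_continuous|exact: continuousR_id].
have lo t : t <= 2^-1 -> b t = 0 by move=> ?; rewrite /b clamp_le0 //; lra.
have hi t : 2^-1 <= t -> a t = 1 by move=> ?; rewrite /a clamp_ge1 //; lra.
have half : 0 < 2^-1 :> R by lra.
have half1 : 2^-1 <= 1 :> R by lra.
(* On each half one of the two moving terms is constant and cancels against the value at the
   junction, so the concatenation is continuous without a gluing argument. *)
exists (fun t => s (a t) + s' (b t) - s 1), (fun t => F (a t) + F' (b t) + - F 1); split.
- apply: continuousR_add; last exact: cst_continuous.
  by apply: continuousR_add; exact: continuousR_comp.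
- apply: mxcontD; last exact: mxcont_cst.
  by apply: mxcontD; exact: mxcont_comp.
- by rewrite (lo _ (ltW half)) ss FF !addrK /a mulr0 clamp_le0.
- have b1 : b 1 = 1 by rewrite /b clamp_ge1 //; lra.
  by rewrite (hi _ half1) b1 [s 1 + _]addrC [F 1 + _]addrC !addrK.
- move=> t /andP[t0 t1]; have [th|/ltW th] := leP t 2^-1.
    by rewrite (lo _ th) ss FF !addrK; apply/H/clamp_itv.
  by rewrite (hi _ th) [s 1 + _]addrC [F 1 + _]addrC !addrK; apply/H'/clamp_itv.
Qed.

Definition frames_over k N (l0 l1 : 'I_k -> R) (r0 r1 : 'I_N -> R) (s : R) (F : 'M[C]_(k, N)) :=
  [/\ 0 <= s <= 1, F *m F^t* = real_diag (fun i => lerp (l0 i) (l1 i) s) &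
      forall j, colsq F j = (lerp (r0 j) (r1 j) s)%:C].

Lemma rank_one_gram k N (U D E : 'M[C]_k) (f : 'cV[C]_k) (G : 'M[C]_(k, N)) :
  U *m D *m U^t* + f *m f^t* = E -> G *m G^t* = D ->
  row_mx f (U *m G) *m (row_mx f (U *m G))^t* = E.
Proof. by move=> <- <-; rewrite row_mx_adj adj_mul !mulmxA. Qed.

(** Only the first column and the unitary applied to the others move. The traces fix the norm of the
    former, and unitary invariance those of the latter. *)
Lemma fiber_joined k N (l0 l1 m : 'I_k -> R) (r0 r1 : 'I_(1 + N) -> R) (s : R)
    (U W : 'M[C]_k) (f g : 'cV[C]_k) (G : 'M[C]_(k, N)) :
  let D := real_diag (fun i => lerp (l0 i) (l1 i) s) in
  U \is unitarymx -> W \is unitarymx ->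
  U *m real_diag m *m U^t* + f *m f^t* = D ->
  W *m real_diag m *m W^t* + g *m g^t* = D ->
  G *m G^t* = real_diag m ->
  0 <= s <= 1 -> (forall j, colsq (row_mx f (U *m G)) j = (lerp (r0 j) (r1 j) s)%:C) ->
  joined (frames_over l0 l1 r0 r1) (s, row_mx f (U *m G)) (s, row_mx g (W *m G)).
Proof.
move=> D Uu Wu EU EW GG s01 Fr.
have [V [v [Vc vc [V0 v0] [V1 v1] P]]] := rank_one_fiber_path Uu Wu EU EW.
exists (fun=> s), (fun t => row_mx (v t) (V t *m G)); split.
- exact: cst_continuous.
- by apply: mxcont_row_mx => //; apply: mxcont_mul => //; exact: mxcont_cst.
- by rewrite V0 v0.
- by rewrite V1 v1.
- move=> t _; have [Vu E] := P t; split=> //; first exact: (rank_one_gram E GG).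
  move=> j; rewrite -Fr !colsq_row_mx; case: fintype.split => a.
    by rewrite (rank_one_colsq _ Vu E) (rank_one_colsq _ Uu EU).
  by rewrite !colsq_unitary.
Qed.

(** The remaining columns are written in an eigenbasis of their own operator, so [G] again has a
    diagonal, sorted operator and is ready for the induction. *)
Lemma split_first_column k N (l : 'I_k -> R) (r : 'I_(1 + N) -> R) (F : 'M[C]_(k, 1 + N)) :
  sorted_desc l -> F *m F^t* = real_diag l -> (forall j, colsq F j = (r j)%:C) ->
  exists m (U : 'M[C]_k) f (G : 'M[C]_(k, N)),
    [/\ [/\ sorted_desc m, U \is unitarymx & F = row_mx f (U *m G)], interlaced l m,
      U *m real_diag m *m U^t* + f *m f^t* = real_diag l, G *m G^t* = real_diag m &
      (forall j, colsq G j = (r (rshift 1 j))%:C) /\ \sum_i l i - \sum_i m i = r (lshift N 0)].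
Proof.
move=> sl; rewrite -[F]hsubmxK; move: (lsubmx F) (rsubmx F) => f G.
rewrite row_mx_adj => E Fr.
have Gh : G *m G^t* \is hermsymmx.
  by apply/is_hermitianmxP; rewrite expr0 scale1r adj_mul trmxCK.
have [m [U [sm Uu GE]]] := hermitian_sorted_spectral Gh.
rewrite GE in E; have UU := unitary_adjl Uu.
exists m, U, f, (U^t* *m G); split=> //.
- by split=> //; rewrite mulmxA (unitary_adjr Uu) mul1mx.
- exact: (rank_one_interlaced sl sm Uu E).
- rewrite adj_mul trmxCK mulmxA -(mulmxA _ G) GE.
  exact: conjugateK.
- split=> [j|].
    rewrite colsq_unitary ?adj_unitary // -Fr colsq_row_mx.
    by rewrite (unsplitK (inr _ j)).
  apply: complexI; rewrite -Fr colsq_row_mx (unsplitK (inl _ 0)).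
  by rewrite (rank_one_colsq _ Uu E) !real_diag_trace rmorphB.
Qed.

Lemma frames_joined N k (l0 l1 : 'I_k -> R) (r0 r1 : 'I_N -> R) (F0 F1 : 'M[C]_(k, N)) :
  sorted_desc l0 -> sorted_desc l1 ->
  F0 *m F0^t* = real_diag l0 -> F1 *m F1^t* = real_diag l1 ->
  (forall j, colsq F0 j = (r0 j)%:C) -> (forall j, colsq F1 j = (r1 j)%:C) ->
  joined (frames_over l0 l1 r0 r1) (0, F0) (1, F1).
Proof.
elim: N l0 l1 r0 r1 F0 F1 => [|N IH] l0 l1 r0 r1 F0 F1 sl0 sl1 E0 E1 C0 C1.
  exists id, (fun=> F0); split.
  - by move=> t; exact: cvg_id.
  - exact: mxcont_cst.
  - by [].
  - by congr (_, _); apply/matrixP => i [].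
  - move=> t t01; split=> //; last by case.
    (* Without columns the operator is [0], so both spectra vanish, and so does their
       interpolation. *)
    have z (F : 'M[C]_(k, 0)) : F *m F^t* = 0.
      by apply/matrixP => i j; rewrite !mxE big_ord0.
    move: E0 E1; rewrite !z => /matrixP e0 /matrixP e1; apply/matrixP => i j.
    have := e0 i j; have := e1 i j; rewrite !mxE; case: (i == j) => //=.
    by move=> [<-] [<-]; rewrite /lerp !mulr0 addr0.
have L0 : real_diag (fun i => lerp (l0 i) (l1 i) 0) = real_diag l0.
  by congr real_diag; apply/funext => i; rewrite lerp0.
have L1 : real_diag (fun i => lerp (l0 i) (l1 i) 1) = real_diag l1.
  by congr real_diag; apply/funext => i; rewrite lerp1.
have [m0 [U0 [f0 [G0 [[sm0 Uu0 F0E] I0 EU0 GG0 [cG0 tr0]]]]]] := split_first_column sl0 E0 C0.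
have [m1 [U1 [f1 [G1 [[sm1 Uu1 F1E] I1 EU1 GG1 [cG1 tr1]]]]]] := split_first_column sl1 E1 C1.
have [g [V [gc Vc P]]] := rank_one_section I0 I1.
pose VM t : 'M[C]_k := \matrix_(i, j) (V i j t)%:C.
pose gM t : 'cV[C]_k := \col_i (g i t)%:C.
have VMc : mxcont VM.
  apply: (mxcont_eq (F := fun i j t => (V i j t)%:C)) => [i j|i j t]; last by rewrite mxE.
  exact: ccont_real.
have gMc : mxcont gM.
  apply: (mxcont_eq (F := fun i j t => (g i t)%:C)) => [i j|i j t]; last by rewrite mxE.
  exact: ccont_real.
have cR (x : R) : Num.conj (x%:C) = x%:C.
  by apply/CrealP; apply/complex_realP; exists x.
have VMu s : 0 <= s <= 1 -> VM s \is unitarymx.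
  move=> /P[P1 _]; apply/unitarymxP/matrixP => i j; rewrite !mxE.
  rewrite -[(i == j)%:R](rmorph_nat (real_complex R)) -P1 rmorph_sum; apply: eq_bigr => a _.
  by rewrite !mxE cR -rmorphM.
have VMe s : 0 <= s <= 1 -> VM s *m real_diag (fun i => lerp (m0 i) (m1 i) s) *m (VM s)^t*
    + gM s *m (gM s)^t* = real_diag (fun i => lerp (l0 i) (l1 i) s).
  move=> /P[_ P2]; apply/matrixP => i j; rewrite !mxE big_ord1 !mxE.
  rewrite -[RHS](rmorphMn (real_complex R)) -P2 rmorphD rmorph_sum; congr (_ + _).
    apply: eq_bigr => a _; rewrite mul_mx_diag !mxE cR.
    by rewrite -!rmorphM; congr (_%:C); ring.
  by rewrite cR -rmorphM.
have i00 : 0 <= (0 : R) <= 1 by rewrite lexx ler01.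
have i11 : 0 <= (1 : R) <= 1 by rewrite lexx ler01.
have M0 : real_diag (fun i => lerp (m0 i) (m1 i) 0) = real_diag m0.
  by congr real_diag; apply/funext => i; rewrite lerp0.
have M1 : real_diag (fun i => lerp (m0 i) (m1 i) 1) = real_diag m1.
  by congr real_diag; apply/funext => i; rewrite lerp1.
have [s [G [sc Gc [s0 Ge0] [s1 Ge1] H]]] := IH m0 m1 _ _ G0 G1 sm0 sm1 GG0 GG1 cG0 cG1.
have VM0 := VMe _ i00; have VM1 := VMe _ i11.
rewrite M0 in VM0; rewrite M1 in VM1.
apply: (joined_trans (q := (0, row_mx (gM 0) (VM 0 *m G0)))).
  rewrite F0E; apply: (fiber_joined Uu0 (VMu _ i00) _ VM0 GG0 i00); first by rewrite L0.
  by move=> j; rewrite -F0E C0 lerp0.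
(* The lift is read at [s t], the parameter of the smaller frame, so the spectra match even while
   that frame pauses. The norm of the new column is a difference of traces, affine in the
   parameter. *)
have mid t : 0 <= t <= 1 -> frames_over l0 l1 r0 r1 (s t) (row_mx (gM (s t)) (VM (s t) *m G t)).
  move=> /H[s01 Ge cG]; split=> //; first exact: (rank_one_gram (VMe _ s01) Ge).
  move=> j; have <- := @splitK 1 N j; case: (@fintype.split 1 N j) => a; rewrite colsq_row_mx unsplitK /=; last first.
    by rewrite colsq_unitary ?VMu // cG.
  rewrite (rank_one_colsq _ (VMu _ s01) (VMe _ s01)) !real_diag_trace !lerp_sum -rmorphB ord1 -tr0 -tr1.
  by congr (_%:C); rewrite /lerp; ring.
apply: (joined_trans (q := (1, row_mx (gM 1) (VM 1 *m G1)))).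
  exists s, (fun t => row_mx (gM (s t)) (VM (s t) *m G t)); split=> //.
  - apply: mxcont_row_mx; first exact: mxcont_comp.
    by apply: mxcont_mul => //; exact: mxcont_comp.
  - by rewrite s0 Ge0.
  - by rewrite s1 Ge1.
rewrite F1E; apply: (fiber_joined (VMu _ i11) Uu1 VM1 _ GG1 i11); first by rewrite L1.
by move=> j; have [_ _] := mid _ i11; rewrite s1 Ge1; apply.
Qed.

End FrameSpaces.

(** * Path-connectedness *)

Section Connectedness.
Context {R : realType}.
Local Notation C := R[i].

Lemma hdotE k (v w : 'cV[C]_k) : hdot v w = (w^t* *m v) 0 0.
Proof.
by rewrite /hdot dotmxE !mxE; apply: eq_bigr => i _; rewrite !mxE mulrC.
Qed.

Lemma hdot_col k N (F : 'M[C]_(k, N)) j : hdot (col j F) (col j F) = colsq F j.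
Proof.
by rewrite hdotE colsqE mxE; apply: eq_bigr => i _; rewrite !mxE normCK mulrC.
Qed.

Lemma frame_operator_form k N (F : 'M[C]_(k, N)) (v : 'cV[C]_k) :
  \sum_j `|hdot v (col j F)| ^+ 2 = hdot (F *m F^t* *m v) v.
Proof.
rewrite [RHS]hdotE -(mulmxA F) (mulmxA (v^t*)).
have -> : v^t* *m F = (F^t* *m v)^t* by rewrite adj_mul trmxCK.
rewrite mxE; apply: eq_bigr => j _.
rewrite [in RHS]mxE [in RHS]mxE mulrC -normCK; congr (`|_| ^+ 2).
by rewrite hdotE !mxE; apply: eq_bigr => i _; rewrite !mxE.
Qed.

Lemma spectral_form k (U : 'M[C]_k) (l : 'I_k -> R) (v : 'cV[C]_k) :
  hdot (U *m real_diag l *m U^t* *m v) v = \sum_i (l i)%:C * `|(U^t* *m v) i 0| ^+ 2.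
Proof.
have -> : U *m real_diag l *m U^t* *m v = U *m (real_diag l *m (U^t* *m v)).
  by rewrite !mulmxA.
rewrite hdotE (mulmxA (v^t*) U); have -> : v^t* *m U = (U^t* *m v)^t* by rewrite adj_mul trmxCK.
move: (U^t* *m v) => w; rewrite mxE; apply: eq_bigr => i _.
by rewrite mul_diag_mx !mxE normCK mulrCA [_^* * _]mulrC.
Qed.

Lemma hdot_unitary k (U : 'M[C]_k) (v : 'cV[C]_k) : U \is unitarymx ->
  hdot v v = \sum_i `|(U^t* *m v) i 0| ^+ 2.
Proof. by move=> Uu; rewrite -colsqE colsq_unitary ?adj_unitary // hdotE. Qed.

(** The extreme eigenvalues of [S] serve as frame bounds, so along a path only the operator and the
    norms need to be controlled. *)
Lemma posdef_is_frame k N (S U : 'M[C]_k) (l : 'I_k -> R) (F : 'M[C]_(k, N)) :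
  (0 < k)%N -> sorted_desc l -> U \is unitarymx -> S = U *m real_diag l *m U^t* ->
  posdefmx S -> F *m F^t* = S -> is_frame F.
Proof.
case: k S U l F => // k S U l F _ sl Uu SE [_ Spos] FS.
have l0 i : 0 < l i.
  pose v : 'cV[C]_k.+1 := U *m delta_mx i 0.
  have Uv : U^t* *m v = delta_mx i 0 by rewrite mulmxA unitary_adjl // mul1mx.
  have v0 : v != 0.
    apply/eqP => z; have /matrixP/(_ i 0) := Uv; rewrite z mulmx0 !mxE !eqxx.
    by move/esym/eqP; rewrite oner_eq0.
  have := Spos v v0; rewrite SE spectral_form Uv (bigD1 i) //= big1 => [|j ji].
    by rewrite !mxE !eqxx normr1 expr1n mulr1 addr0 ltcR.
  by rewrite !mxE (negbTE ji) normr0 expr0n mulr0.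
exists (l ord_max), (l ord0); split=> [||v]; first exact: l0.
  by apply: sl; exact: leq0n.
rewrite frame_operator_form FS SE spectral_form (hdot_unitary v Uu) !mulr_sumr.
apply/andP; split; apply: ler_sum => i _; rewrite ler_wpM2r ?exprn_ge0 // lecR; apply: sl.
  exact: leq_ord.
exact: leq0n.
Qed.

Lemma mxcont_continuous k N (F : R -> 'M[C]_(k, N)) : mxcont F -> continuous F.
Proof.
move=> Fc t A [P PF sPA].
suff : \forall s \near t, forall i j, P i j (F s i j) by apply: filterS => s /sPA.
apply: (@filter_forall R 'I_k (fun i s => forall j, P i j (F s i j)) (nbhs t) _) => i.
apply: (@filter_forall R 'I_N (fun j s => P i j (F s i j)) (nbhs t) _) => j.
have := PF i j; have [rc ic] := Fc i j.
move=> /nbhs_ballP[e /= e0 He].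
(* Radii of balls in [R[i]] are complex numbers; being positive, [e] is real. *)
have [er] : exists er, e = er%:C by apply/complex_realP; exact: gtr0_real.
move=> eE; rewrite eE ltcR in e0.
have e2 : 0 < er / 2 by lra.
have /cvgrPdist_lt/(_ _ e2) H1 := rc t; have /cvgrPdist_lt/(_ _ e2) H2 := ic t.
near=> s; apply: He; rewrite /ball /= eE.
have h1 : `|complex.Re (F t i j) - complex.Re (F s i j)| < er / 2 by near: s.
have h2 : `|complex.Im (F t i j) - complex.Im (F s i j)| < er / 2 by near: s.
move: h1 h2; case: (F t i j) (F s i j) => [a b] [c d] /= h1 h2.
rewrite normc_def ltcR /= -(ger0_norm (ltW e0)) -sqrtr_sqr ltr_sqrt; last nra.
move: h1 h2; rewrite !ltr_norml => /andP[? ?] /andP[? ?]; nra.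
Unshelve. all: by end_near. Qed.

End Connectedness.

Theorem mainTheorem1 (R : realType) (k N : nat) (S : 'M[R[i]]_k)
    (r : 'I_N -> R) :
  (0 < k)%N -> (0 < N)%N ->
  S \in unitmx -> posdefmx S ->
  admissible S r ->
  path_connected R (frame_space S r).
Proof.
move=> k0 _ _ Spos [_ [F [[W Wu FW] Fr]]].
have [l [U [sl Uu SE]]] := hermitian_sorted_spectral Spos.1.
have frP (G : 'M[R[i]]_(k, N)) : G *m G^t* = S -> has_sqnorms r G -> frame_space S r G.
  by move=> GS Gr; split=> //; exact: (posdef_is_frame k0 sl Uu SE Spos GS).
split.
  (* Undoing [W] turns the operator of an admissible frame into [S] and keeps the column norms. *)
  exists (W^t* *m F); apply: frP.
    have -> : W^t* *m F *m (W^t* *m F)^t* = W^t* *m (F *m F^t*) *m W.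
      by rewrite adj_mul trmxCK !mulmxA.
    by rewrite FW conjugateK.
  by move=> j; rewrite hdot_col colsq_unitary ?adj_unitary // -hdot_col.
move=> F0 F1 [_ S0 r0] [_ S1 r1].
have key (G : 'M[R[i]]_(k, N)) : G *m G^t* = S -> (U^t* *m G) *m (U^t* *m G)^t* = real_diag l.
  move=> GS; rewrite adj_mul trmxCK mulmxA -(mulmxA _ G) GS SE; exact: conjugateK.
have keyr G : has_sqnorms r G -> forall j, colsq (U^t* *m G) j = (r j)%:C.
  by move=> Gr j; rewrite colsq_unitary ?adj_unitary // -hdot_col.
(* Both ends have the same spectrum and norms, so all interpolations are constant and the value of
   [s] is immaterial. *)
have [s [G [sc Gc [_ G0] [_ G1] H]]] :=
  frames_joined sl sl (key _ S0) (key _ S1) (keyr _ r0) (keyr _ r1).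
have lerp_cst (a t : R) : lerp a a t = a by rewrite /lerp; ring.
exists (fun t => U *m G t); split.
- apply: continuous_subspaceT; apply: mxcont_continuous.
  by apply: mxcont_mul => //; exact: mxcont_cst.
- by rewrite G0 mulmxA unitary_adjr // mul1mx.
- by rewrite G1 mulmxA unitary_adjr // mul1mx.
- move=> t /H[_ GG Gr]; apply: frP.
    rewrite adj_mul mulmxA -(mulmxA _ (G t)) GG SE; congr (_ *m _ *m _); congr real_diag.
    by apply/funext => i; rewrite lerp_cst.
  by move=> j; rewrite hdot_col colsq_unitary // Gr lerp_cst.
Qed.
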